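(* Let $n\ge1$. Let $\mathcal U_q$ denote $\mathcal U_q(\mathfrak{gl}(m|n))$ or $\mathcal U_q(\mathfrak{sl}(m|n))$, and when $\mathbf{char}(q)=\ell>2$ let $u_q$ denote $u_q(\mathfrak{gl}(m|n))$ or $u_q(\mathfrak{sl}(m|n))$. For every $t\in\mathbb Z_{\ge0}$ the homogeneous subspace $\Omega_q^!(m|n)^{(t)}$ is a $\mathcal U_q$-submodule of $\Omega_q^!(m|n)$, and $\Omega_q^!(m|n,\mathbf 1)^{(t)}$ is a $u_q$-submodule of $\Omega_q^!(m|n,\mathbf 1)$ when $\mathbf{char}(q)=\ell>2$. Moreover: (i) If $\mathbf{char}(q)=0$, then for $t\le m$ the submodule $\Omega_q^!(m|n)^{(t)}\cong V(\omega_t)$ is a simple module generated by the highest weight vector $x^{\omega_t}\otimes1$, where $\omega_t=\epsilon_1+\cdots+\epsilon_t$; and for $t>m$ the submodule $\Omega_q^!(m|n)^{(t)}\cong V(\omega_m+(t-m)\epsilon_{m+1})$ is a simple module generated by the highest weight vector $x^{\omega_m}\otimes x^{((t-m)\epsilon_{m+1})}$. (ii) If $\mathbf{char}(q)=\ell$ $(>2)$, then for $t\le m$, $\Omega_q^!(m|n,\mathbf 1)^{(t)}\cong V(\omega_t)$; and for $m<t\le m+n(\ell-1)$, writing $t-m=(i-1)(\ell-1)+t_i$ with $1\le i\le n$, $0\le t_i\le\ell-1$, the submodule $$\Omega_q^!(m|n,\mathbf 1)^{(t)}\cong V\bigl(\omega_m+(\ell-1)\epsilon_{m+1}+\cdots+(\ell-1)\epsilon_{m+(i-1)}+t_i\epsilon_{m+i}\bigr)$$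 is a simple module generated by the highest weight vector $x^{\omega_m}\otimes x^{((\ell-1)\epsilon_{m+1}+\cdots+(\ell-1)\epsilon_{m+(i-1)}+t_i\epsilon_{m+i})}$.
   Context: $\Bbbk$ is an algebraically closed field of characteristic zero, $q\in\Bbbk^\times$, $q^2\ne1$; $m,n\ge 0$ are integers, $I_0=\{1,\dots,m\}$, $I_1=\{m+1,\dots,m+n\}$, $I=I_0\cup I_1$, $J=\{1,\dots,m+n-1\}$. $[s]=\frac{q^s-q^{-s}}{q-q^{-1}}$; $q$-binomials ${s\brack r}=\prod_{i=1}^r\frac{v^{s-i+1}-v^{-s+i-1}}{v^i-v^{-i}}\in\mathbb Z[v,v^{-1}]$ are evaluated at $v=q$. $\mathbf{char}(q)$ is the least positive integer $\ell$ with $[\ell]=0$, and $0$ if none exists. For $a,b\in\mathbb Z^{m+n}$ put $a*b=\sum_{i>j}a_ib_j$; $\epsilon_i$ are the standard basis vectors. In this statement $\mu=(\mu_1,\dots,\mu_m)\in\{0,1\}^m$ (identified with $\mathbb Z_2^m$) is regarded as supported on $I_0$ and $\alpha=(\alpha_{m+1},\dots,\alpha_{m+n})\in\mathbb Z^n$ as supported on $I_1$; $|\cdot|$ is the sum of the entries. Quantum dual Grassmann superalgebra. $\Omega_q^!(m|n)=\Lambda_q(m)\otimes\mathcal A_{q^{-1}}(n)$ has basis $x^\mu\otimes x^{(\alpha)}$, $\mu\in\{0,1\}^m$, $\alpha\in\mathbb Z_{\ge0}^n$, with multiplication $$(x^\mu\otimes x^{(\alpha)})(x^\nu\otimes x^{(\beta)})=(-q)^{-\alpha*\nu}\,x^\mu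 x^\nu\otimes x^{(\alpha)}x^{(\beta)},$$ where $x^\mu x^\nu=(-q)^{-\mu*\nu}x^{\mu+\nu}$ (zero if $\mu+\nu\notin\{0,1\}^m$) and $x^{(\alpha)}x^{(\beta)}=q^{-\alpha*\beta}\prod_{i\in I_1}{\alpha_i+\beta_i\brack\alpha_i}\,x^{(\alpha+\beta)}$. If $\mathbf{char}(q)=\ell\ge3$, $\Omega_q^!(m|n,\mathbf 1)$ is the subalgebra spanned by those $x^\mu\otimes x^{(\alpha)}$ with all $\alpha_i\le\ell-1$. For $t\ge0$, ${\Omega_q^!}^{(t)}$ is the span of the basis elements $x^\mu\otimes x^{(\alpha)}\in\Omega_q^!$ with $|\mu|+|\alpha|=t$, where $\Omega_q^!=\Omega_q^!(m|n)$ or $\Omega_q^!(m|n,\mathbf 1)$. Operators on $\Omega_q^!$ (with $x^{(\beta)}=0$ if some $\beta_i<0$, and in the restricted case also if some $\beta_i\geq \ell$). For $j\in I_0$: $x_j(x^\nu\otimes x^{(\alpha)})=(-q)^{-\epsilon_j*\nu}\delta_{\nu_j,0}\,x^{\nu+\epsilon_j}\otimes x^{(\alpha)}$, $\partial_j(x^\nu\otimes x^{(\alpha)})=(-q)^{\epsilon_j*\nu}\delta_{\nu_j,1}\,x^{\nu-\epsilon_j}\otimes x^{(\alpha)}$, $\sigma_j(x^\nu\otimes x^{(\alpha)})=q^{\nu_j}x^\nu\otimes x^{(\alpha)}$. For $j\in I_1$: $x_j(x^\nu\otimes x^{(\alpha)})=(-q)^{-\epsilon_j*\nu}q^{-\epsilon_j*\alpha}[\alpha_j+1]\,x^\nu\otimes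 x^{(\alpha+\epsilon_j)}$, $\partial_j(x^\nu\otimes x^{(\alpha)})=(-q)^{\epsilon_j*\nu}q^{\epsilon_j*\alpha}\,x^\nu\otimes x^{(\alpha-\epsilon_j)}$, $\sigma_j(x^\nu\otimes x^{(\alpha)})=q^{-\alpha_j}x^\nu\otimes x^{(\alpha)}$. Quantum superalgebra and bosonization. Put $q_i=q$ for $i\in I_0$, $q_i=q^{-1}$ for $i\in I_1$, $p(i)=\delta_{im}$. $U_q(\mathfrak{gl}(m|n))$ is generated by $E_j,F_j$ $(j\in J)$, $K_i^{\pm1}$ $(i\in I)$, where $\mathcal K_i=K_iK_{i+1}^{-1}$, with relations (whenever all indices are in range): $K_iK_j=K_jK_i$, $K_iK_i^{-1}=1=K_i^{-1}K_i$; $K_iE_j=q_i^{\delta_{ij}-\delta_{i,j+1}}E_jK_i$, $K_iF_j=q_i^{-\delta_{ij}+\delta_{i,j+1}}F_jK_i$; $E_iF_j-(-1)^{p(i)p(j)}F_jE_i=\delta_{ij}\frac{\mathcal K_i-\mathcal K_i^{-1}}{q_i-q_i^{-1}}$; $E_iE_j=E_jE_i$, $F_iF_j=F_jF_i$ for $|i-j|>1$; $E_i^2E_j-(q+q^{-1})E_iE_jE_i+E_jE_i^2=0$ for $|i-j|=1$, $i\ne m$, and likewise for $F$; $E_m^2=F_m^2=0$; $E_{m-1}E_mE_{m+1}E_m+E_mE_{m-1}E_mE_{m+1}+E_{m+1}E_mE_{m-1}E_m+E_mE_{m+1}E_mE_{m-1}-(q+q^{-1})E_mE_{m-1}E_{m+1}E_m=0$,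 and likewise for $F$. The bosonization $\mathcal U_q(\mathfrak{gl}(m|n))$ is generated by $U_q(\mathfrak{gl}(m|n))$ and $\sigma$ with $\sigma^2=1$, $\sigma E_j\sigma=(-1)^{p(j)}E_j$, $\sigma F_j\sigma=(-1)^{p(j)}F_j$, $\sigma K_i\sigma=K_i$. $\mathcal U_q(\mathfrak{sl}(m|n))$ is the analogue with $\mathcal K_j^{\pm1}$ $(j\in J)$ in place of the $K_i^{\pm1}$ (generated by $E_j,F_j,\mathcal K_j^{\pm1},\sigma$). When $\mathbf{char}(q)=\ell>2$, $u_q=\mathcal U_q/(E_i^\ell,F_i^\ell\ (m\ne i\in J),\ E_m^2,\ F_m^2,\ K_i^{2\ell}-1)$ (for $\mathfrak{sl}$, $\mathcal K_i^{2\ell}-1$). Action. $\Omega_q^!(m|n)$ is a $\mathcal U_q$-module, and $\Omega_q^!(m|n,\mathbf 1)$ a $u_q$-module, via: $E_j$ acts as $x_j\partial_{j+1}\sigma_j$, $F_j$ as $\sigma_j^{-1}x_{j+1}\partial_j$ $(j\in J)$, $K_j$ as $\sigma_j$ $(j\in I)$, $\mathcal K_j$ as $\sigma_j\sigma_{j+1}^{-1}$, and $\sigma$ by $x^\mu\otimes x^{(\alpha)}\mapsto(-1)^{|\alpha|}x^\mu\otimes x^{(\alpha)}$. Weights. $\omega_i=\epsilon_1+\cdots+\epsilon_i$, $\omega_0=0$; the bilinear form is $(\epsilon_i,\epsilon_j)=\delta_{ij}$ for $i\in I_0$ and $-\delta_{ij}$ for $i\in I_1$. A highest weight vector of weight $\lambda\in\bigoplus_i\mathbb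 Z\epsilon_i$ is a nonzero $v$ with $E_jv=0$ $(j\in J)$ and $K_iv=q^{(\lambda,\epsilon_i)}v$ $(i\in I)$ (for $\mathfrak{sl}$: $\mathcal K_jv=q^{(\lambda,\epsilon_j-\epsilon_{j+1})}v$, $j\in J$); $V(\lambda)$ denotes the simple module generated by a highest weight vector of weight $\lambda$. *)

(* Defs.v *)
From HB Require Import structures.
From mathcomp Require Import all_boot all_order all_algebra.
From mathcomp Require Import finmap.
From mathcomp Require Import boolp.
From mathcomp.multinomials Require Import monalg.

Set Implicit Arguments.
Unset Strict Implicit.
Unset Printing Implicit Defensive.

Import Order.TTheory GRing.Theory Num.Theory.
Local Open Scope ring_scope.
Local Open Scope quotient_scope.

Section PresentedAlgebra.

Variables (K : comNzRingType) (A : lalgType K) (R : A -> A -> Prop).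

(* R l r stands for the relation l = r. *)
Inductive ideal_gen : A -> Prop :=
| ideal_gen_rel l r : R l r -> ideal_gen (l - r)
| ideal_gen0 : ideal_gen 0
| ideal_genB x y : ideal_gen x -> ideal_gen y -> ideal_gen (x - y)
| ideal_genMl a x : ideal_gen x -> ideal_gen (a * x)
| ideal_genMr a x : ideal_gen x -> ideal_gen (x * a).

Definition in_ideal : {pred A} := fun x => `[< ideal_gen x >].

Lemma in_idealP x : reflect (ideal_gen x) (x \in in_ideal).
Proof. exact: asboolP. Qed.

Fact in_ideal_zmod_closed : zmod_closed in_ideal.
Proof.
split=> [|x y /in_idealP Ix /in_idealP Iy]; apply/in_idealP.
  exact: ideal_gen0.
exact: ideal_genB.
Qed.

HB.instance Definition _ :=
  GRing.isZmodClosed.Build A in_ideal in_ideal_zmod_closed.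

Definition presented : Type := Quotient.quot in_ideal.

HB.instance Definition _ := GRing.Zmodule.on presented.

Definition presented_pi (x : A) : presented := \pi_(Quotient.quot in_ideal) x.
Definition presented_repr (x : presented) : A :=
  repr (x : Quotient.quot in_ideal).

Lemma presented_reprK : cancel presented_repr presented_pi.
Proof. exact: reprK. Qed.

Lemma presented_eqP x y :
  reflect (presented_pi x = presented_pi y) (x - y \in in_ideal).
Proof. by rewrite Quotient.idealrBE; apply: eqP. Qed.

Lemma presented_piD : {morph presented_pi : x y / x + y}.
Proof. by move=> x y; exact: Quotient.pi_add. Qed.

Definition presented_one : presented := presented_pi 1.
Definition presented_mul (x y : presented) : presented :=
  presented_pi (presented_repr x * presented_repr y).
Definition presented_scale (k : K) (x : presented) : presented :=
  presented_pi (k *: presented_repr x).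

Lemma presented_piM x y :
  presented_mul (presented_pi x) (presented_pi y) = presented_pi (x * y).
Proof.
apply/presented_eqP/in_idealP.
set x' := presented_repr _; set y' := presented_repr _.
have /in_idealP Ix : x' - x \in in_ideal.
  by apply/presented_eqP; exact: presented_reprK.
have /in_idealP Iy : y - y' \in in_ideal.
  by apply/presented_eqP; rewrite presented_reprK.
have -> : x' * y' - x * y = (x' - x) * y' - x * (y - y').
  by rewrite mulrBl mulrBr opprB addrA subrK.
by apply: ideal_genB; [apply: ideal_genMr | apply: ideal_genMl].
Qed.

Lemma presented_piZ k x :
  presented_scale k (presented_pi x) = presented_pi (k *: x).
Proof.
apply/presented_eqP/in_idealP; rewrite -scalerBr.
set x' := presented_repr _.
have /in_idealP Ix : x' - x \in in_ideal.
  by apply/presented_eqP; exact: presented_reprK.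
by rewrite -[x' - x]mul1r scalerAl; apply: ideal_genMl.
Qed.

Lemma presented_ind (P : presented -> Prop) :
  (forall x, P (presented_pi x)) -> forall x, P x.
Proof. by move=> IH x; rewrite -[x]presented_reprK. Qed.

Fact presented_mulA : associative presented_mul.
Proof.
elim/presented_ind=> x; elim/presented_ind=> y; elim/presented_ind=> z.
by rewrite !presented_piM mulrA.
Qed.
Fact presented_mul1 : left_id presented_one presented_mul.
Proof. by elim/presented_ind=> x; rewrite presented_piM mul1r. Qed.
Fact presented_mulr1 : right_id presented_one presented_mul.
Proof. by elim/presented_ind=> x; rewrite presented_piM mulr1. Qed.
Fact presented_mulDl : left_distributive presented_mul +%R.
Proof.
elim/presented_ind=> x; elim/presented_ind=> y; elim/presented_ind=> z.
by rewrite -presented_piD !presented_piM mulrDl presented_piD.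
Qed.
Fact presented_mulDr : right_distributive presented_mul +%R.
Proof.
elim/presented_ind=> x; elim/presented_ind=> y; elim/presented_ind=> z.
by rewrite -presented_piD !presented_piM mulrDr presented_piD.
Qed.

HB.instance Definition _ := GRing.Zmodule_isPzRing.Build presented
  presented_mulA presented_mul1 presented_mulr1 presented_mulDl presented_mulDr.

Fact presented_scaleA a b v :
  presented_scale a (presented_scale b v) = presented_scale (a * b) v.
Proof. by elim/presented_ind: v => v; rewrite !presented_piZ scalerA. Qed.
Fact presented_scale1 : left_id 1 presented_scale.
Proof. by elim/presented_ind=> x; rewrite presented_piZ scale1r. Qed.
Fact presented_scaleDr : right_distributive presented_scale +%R.
Proof.
move=> k; elim/presented_ind=> x; elim/presented_ind=> y.
by rewrite -presented_piD !presented_piZ scalerDr presented_piD.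
Qed.
Fact presented_scaleDl v : {morph presented_scale^~ v : a b / a + b}.
Proof.
elim/presented_ind: v => v a b.
by rewrite !presented_piZ scalerDl presented_piD.
Qed.

HB.instance Definition _ := GRing.Zmodule_isLmodule.Build K presented
  presented_scaleA presented_scale1 presented_scaleDr presented_scaleDl.

Lemma presented_scaleAl (a : K) (u v : presented) :
  a *: (u * v) = (a *: u) * v.
Proof.
elim/presented_ind: u => u; elim/presented_ind: v => v.
rewrite /GRing.mul /GRing.scale /=.
by rewrite presented_piZ !presented_piM presented_piZ scalerAl.
Qed.

End PresentedAlgebra.

Section Modules.

Variables (K : comNzRingType) (A : lalgType K) (R : A -> A -> Prop).
Variables (V : lmodType K) (act : presented R -> V -> V).

(* A module structure on V: act is a unital K-algebra morphism to End_K(V). *)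
Definition is_action : Prop :=
  [/\ forall v, linear (act^~ v), forall u, linear (act u),
      forall v, act 1 v = v
    & forall u u' v, act (u * u') v = act u (act u' v)].

Definition is_submodule (N : V -> Prop) : Prop :=
  [/\ N 0, forall v w, N v -> N w -> N (v + w),
      forall (c : K) v, N v -> N (c *: v)
    & forall u v, N v -> N (act u v)].

Definition is_simple (N : V -> Prop) : Prop :=
  [/\ is_submodule N, exists2 v, N v & v != 0
    & forall N' : V -> Prop, is_submodule N' -> (forall v, N' v -> N v) ->
        (forall v, N' v -> v = 0) \/ (forall v, N v -> N' v)].

Definition generated_by (v : V) (N : V -> Prop) : Prop :=
  forall w, N w <-> exists u, w = act u v.

End Modules.

Section QuantumNumbers.

Variables (K : fieldType) (q : K).

Definition qnum (s : int) : K := (q ^ s - q ^ (- s)) / (q - q^-1).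

Definition qchar : nat :=
  if pselect (exists s : nat, (0 < s)%N && (qnum s%:Z == 0)) is left ex
  then ex_minn ex else 0%N.

End QuantumNumbers.

(* Indices are 0-based: [i : 'I_(m + n)] stands for the index i+1 in I, and
[j : 'I_(m + n).-1] for the index j+1 in J; thus i is in I_0 iff i < m. *)

Section Lattice.

Variables m n : nat.

Local Notation wt := {ffun 'I_(m + n) -> int}.

(* [eps k] is the (k+1)-st standard basis vector; it is 0 for k >= m + n. *)
Definition eps (k : nat) : wt :=
  [ffun i : 'I_(m + n) => if (i : nat) == k then 1 else 0].

Definition omega (k : nat) : wt := \sum_(0 <= i < k) eps i.

Definition part0 (a : wt) : wt :=
  [ffun i : 'I_(m + n) => if (i < m)%N then a i else 0].
Definition part1 (a : wt) : wt :=
  [ffun i : 'I_(m + n) => if (i < m)%N then 0 else a i].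

Definition star (a b : wt) : int :=
  \sum_(i < m + n) \sum_(j < m + n | (j < i)%N) a i * b j.

Definition degree (a : wt) : int := \sum_(i < m + n) a i.

Definition form (a b : wt) : int :=
  \sum_(i < m + n) (if (i < m)%N then a i * b i else - (a i * b i)).

Fact node_proof (j : 'I_(m + n).-1) : (j.+1 < m + n)%N.
Proof. by rewrite -ltn_predRL. Qed.

(* The two indices joined by the node j of the Dynkin diagram. *)
Definition lo (j : 'I_(m + n).-1) : 'I_(m + n) := Ordinal (ltnW (node_proof j)).
Definition hi (j : 'I_(m + n).-1) : 'I_(m + n) := Ordinal (node_proof j).

(* p(j) = 1, i.e. j+1 = m: the node joining I_0 and I_1. *)
Definition odd_node (j : 'I_(m + n).-1) : bool := j.+1 == m.

Definition adjacent (i j : 'I_(m + n).-1) : bool :=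
  (i.+1 == j) || (j.+1 == i).

Definition distant (i j : 'I_(m + n).-1) : bool :=
  (i.+1 < j)%N || (j.+1 < i)%N.

End Lattice.

Arguments eps {m n} k.
Arguments omega {m n} k.

Variant lie_type := GL | SL.

Section Generators.

Variables (m n : nat) (g : lie_type).

(* The toral generators are the K_i, i in I, for gl, and the
   K_j K_(j+1)^-1, j in J, for sl. *)
Definition torus_size : nat :=
  match g with GL => (m + n)%N | SL => (m + n).-1 end.

Inductive generator : Type :=
| genE of 'I_(m + n).-1
| genF of 'I_(m + n).-1
| genK of 'I_torus_size
| genKV of 'I_torus_size
| gensigma.

Definition generator_code (x : generator) :
    'I_(m + n).-1 + 'I_(m + n).-1 + 'I_torus_size + 'I_torus_size + unit :=
  match x with
  | genE j => inl (inl (inl (inl j)))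
  | genF j => inl (inl (inl (inr j)))
  | genK t => inl (inl (inr t))
  | genKV t => inl (inr t)
  | gensigma => inr tt
  end.
Definition generator_decode
    (x : 'I_(m + n).-1 + 'I_(m + n).-1 + 'I_torus_size + 'I_torus_size + unit) :=
  match x with
  | inl (inl (inl (inl j))) => genE j
  | inl (inl (inl (inr j))) => genF j
  | inl (inl (inr t)) => genK t
  | inl (inr t) => genKV t
  | inr _ => gensigma
  end.
Fact generator_codeK : cancel generator_code generator_decode.
Proof. by case. Qed.
HB.instance Definition _ :=
  Choice.copy generator (can_type generator_codeK).

End Generators.

Section QuantumSuperalgebra.

Variables (K : fieldType) (q : K) (m n : nat).

Local Notation free_alg g := {malg K[{fmonom (generator m n g)}]}.

Definition gen g (x : generator m n g) : free_alg g := << fmu x >>.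

Definition q_ (i : 'I_(m + n)) : K := if (i < m)%N then q else q^-1.

(* The scalar c with K_i E_j = c E_j K_i and K_i F_j = c^-1 F_j K_i. *)
Definition comm_coef (i : 'I_(m + n)) (j : 'I_(m + n).-1) : K :=
  q_ i ^ ((if i == lo j then 1 else 0) - (if i == hi j then 1 else 0)).

(* The same scalar for any toral generator; for sl it is obtained from
   those of the two factors of K_i K_(i+1)^-1. *)
Definition torus_coef g : 'I_(torus_size m n g) -> 'I_(m + n).-1 -> K :=
  match g with
  | GL => fun i j => comm_coef i j
  | SL => fun i j => comm_coef (lo i) j / comm_coef (hi i) j
  end.

(* calK j is K_j K_(j+1)^-1 and calKV j is its inverse. *)
Definition calK g : 'I_(m + n).-1 -> free_alg g :=
  match g with
  | GL => fun j => @gen GL (genK (lo j : 'I_(torus_size m n GL)))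
                   * @gen GL (genKV (hi j : 'I_(torus_size m n GL)))
  | SL => fun j => @gen SL (genK (j : 'I_(torus_size m n SL)))
  end.
Definition calKV g : 'I_(m + n).-1 -> free_alg g :=
  match g with
  | GL => fun j => @gen GL (genKV (lo j : 'I_(torus_size m n GL)))
                   * @gen GL (genK (hi j : 'I_(torus_size m n GL)))
  | SL => fun j => @gen SL (genKV (j : 'I_(torus_size m n SL)))
  end.

Variable g : lie_type.

Local Notation E j := (gen (@genE m n g j)).
Local Notation F j := (gen (@genF m n g j)).
Local Notation Kt t := (gen (@genK m n g t)).
Local Notation KVt t := (gen (@genKV m n g t)).
Local Notation sigma := (gen (@gensigma m n g)).
Local Notation p := (@odd_node m n).

(* r = None gives the bosonization; r = Some l adds the relations of its
   restricted quotient u_q. *)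
Inductive Uq_rel (r : option nat) : free_alg g -> free_alg g -> Prop :=
| rel_KK s t : Uq_rel r (Kt s * Kt t) (Kt t * Kt s)
| rel_KKV t : Uq_rel r (Kt t * KVt t) 1
| rel_KVK t : Uq_rel r (KVt t * Kt t) 1
| rel_KE t j : Uq_rel r (Kt t * E j) (torus_coef t j *: (E j * Kt t))
| rel_KF t j : Uq_rel r (Kt t * F j) ((torus_coef t j)^-1 *: (F j * Kt t))
| rel_EF i j :
    Uq_rel r (E i * F j - (-1) ^+ (p i && p j) * (F j * E i))
      (if i == j then (q_ (lo i) - (q_ (lo i))^-1)^-1 *: (calK g i - calKV g i)
       else 0)
| rel_EE i j : distant i j -> Uq_rel r (E i * E j) (E j * E i)
| rel_FF i j : distant i j -> Uq_rel r (F i * F j) (F j * F i)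
| rel_serreE i j : adjacent i j -> ~~ p i ->
    Uq_rel r (E i ^+ 2 * E j - (q + q^-1) *: (E i * E j * E i) + E j * E i ^+ 2)
      0
| rel_serreF i j : adjacent i j -> ~~ p i ->
    Uq_rel r (F i ^+ 2 * F j - (q + q^-1) *: (F i * F j * F i) + F j * F i ^+ 2)
      0
| rel_oddE j : p j -> Uq_rel r (E j ^+ 2) 0
| rel_oddF j : p j -> Uq_rel r (F j ^+ 2) 0
| rel_quarticE (i j k : 'I_(m + n).-1) : p j -> i.+1 = j :> nat -> k = j.+1 :> nat ->
    Uq_rel r (E i * E j * E k * E j + E j * E i * E j * E k
              + E k * E j * E i * E j + E j * E k * E j * E i
              - (q + q^-1) *: (E j * E i * E k * E j)) 0
| rel_quarticF (i j k : 'I_(m + n).-1) : p j -> i.+1 = j :> nat -> k = j.+1 :> nat ->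
    Uq_rel r (F i * F j * F k * F j + F j * F i * F j * F k
              + F k * F j * F i * F j + F j * F k * F j * F i
              - (q + q^-1) *: (F j * F i * F k * F j)) 0
| rel_ss : Uq_rel r (sigma ^+ 2) 1
| rel_sE j : Uq_rel r (sigma * E j * sigma) ((-1) ^+ p j * E j)
| rel_sF j : Uq_rel r (sigma * F j * sigma) ((-1) ^+ p j * F j)
| rel_sK t : Uq_rel r (sigma * Kt t * sigma) (Kt t)
| rel_El l j : r = Some l -> ~~ p j -> Uq_rel r (E j ^+ l) 0
| rel_Fl l j : r = Some l -> ~~ p j -> Uq_rel r (F j ^+ l) 0
| rel_Kl l t : r = Some l -> Uq_rel r (Kt t ^+ (2 * l)) 1.

Definition Uq (r : option nat) := presented (Uq_rel r).

Definition Ugen (r : option nat) (x : generator m n g) : Uq r :=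
  presented_pi (Uq_rel r) (gen x).

End QuantumSuperalgebra.

Section DualGrassmann.

Variables (K : fieldType) (q : K) (m n : nat) (r : option nat).

Local Notation wt := {ffun 'I_(m + n) -> int}.

(* x^mu (x) x^(alpha) is indexed by the concatenation of mu in {0,1}^m and
   alpha in N^n; r = Some l is the restricted case alpha_i <= l - 1. *)
Definition admissible (a : wt) : bool :=
  [forall i : 'I_(m + n),
     (0 <= a i) && (if (i < m)%N then a i <= 1
                    else if r is Some l then a i < l%:Z else true)].

Definition basis : Type := {a : wt | admissible a}.
HB.instance Definition _ := Choice.on basis.

Definition Omega : Type := {malg K[basis]}.
HB.instance Definition _ := GRing.Lmodule.on Omega.

(* The basis vector of exponent a, or 0 if a is out of range. *)
Definition mon (a : wt) : Omega :=
  if insub a is Some b then (<< (b : basis) >> : {malg K[basis]}) else 0.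

Definition lin_ext (f : wt -> Omega) (v : Omega) : Omega :=
  \sum_(b <- msupp (v : {malg K[basis]}))
    (v : {malg K[basis]})@_b *: f (val b).

Definition homog (t : nat) (v : Omega) : Prop :=
  forall b : basis, b \in msupp (v : {malg K[basis]}) ->
    degree (val b) = t%:Z.

Definition x_op (j : 'I_(m + n)) : Omega -> Omega := lin_ext (fun a =>
  if (j < m)%N then
    if a j == 0 then (- q) ^ (- star (eps j) (part0 a)) *: mon (a + eps j)
    else 0
  else ((- q) ^ (- star (eps j) (part0 a)) * q ^ (- star (eps j) (part1 a))
        * qnum q (a j + 1)) *: mon (a + eps j)).

Definition d_op (j : 'I_(m + n)) : Omega -> Omega := lin_ext (fun a =>
  if (j < m)%N then
    if a j == 1 then (- q) ^ star (eps j) (part0 a) *: mon (a - eps j)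
    else 0
  else ((- q) ^ star (eps j) (part0 a) * q ^ star (eps j) (part1 a))
       *: mon (a - eps j)).

Definition sigma_op (j : 'I_(m + n)) : Omega -> Omega := lin_ext (fun a =>
  q ^ (if (j < m)%N then a j else - a j) *: mon a).

Definition sigmaV_op (j : 'I_(m + n)) : Omega -> Omega := lin_ext (fun a =>
  q ^ (- (if (j < m)%N then a j else - a j)) *: mon a).

Definition parity_op : Omega -> Omega := lin_ext (fun a =>
  (-1) ^ degree (part1 a) *: mon a).

Definition torus_op g : 'I_(torus_size m n g) -> Omega -> Omega :=
  match g with
  | GL => fun i => sigma_op i
  | SL => fun j => sigma_op (lo j) \o sigmaV_op (hi j)
  end.

(* The generators act by the prescribed operators; K_t^-1 then necessarily
   acts by the inverse of the operator of K_t. *)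
Definition is_natural g (act : Uq q m n g r -> Omega -> Omega) : Prop :=
  [/\ forall j v, act (Ugen q r (genE g j)) v
                  = x_op (lo j) (d_op (hi j) (sigma_op (lo j) v)),
      forall j v, act (Ugen q r (genF g j)) v
                  = sigmaV_op (lo j) (x_op (hi j) (d_op (lo j) v)),
      forall t v, act (Ugen q r (genK t)) v = torus_op t v
    & forall v, act (Ugen q r (gensigma m n g)) v = parity_op v].

End DualGrassmann.

Arguments mon {K m n r} a.
Arguments homog {K m n r} t v.

Section HighestWeight.

Variables (K : fieldType) (q : K) (m n : nat) (g : lie_type) (r : option nat).

Local Notation wt := {ffun 'I_(m + n) -> int}.

(* The weight paired with lambda in the eigenvalue of a toral generator. *)
Definition torus_wt g' : 'I_(torus_size m n g') -> wt :=
  match g' with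
  | GL => fun i => eps i
  | SL => fun j => eps (lo j) - eps (hi j)
  end.

Variables (V : lmodType K) (act : Uq q m n g r -> V -> V).

Definition is_highest_weight_vector (lambda : wt) (v : V) : Prop :=
  [/\ v != 0, forall j, act (Ugen q r (genE g j)) v = 0
    & forall t, act (Ugen q r (genK t)) v
                = q ^ form lambda (torus_wt t) *: v].

(* The subspace N is a simple module generated by its highest weight vector
   v of weight lambda. *)
Definition is_simple_hw (N : V -> Prop) (lambda : wt) (v : V) : Prop :=
  [/\ is_simple act N, is_highest_weight_vector lambda v
    & generated_by act v N].

(* N is isomorphic to V(lambda), the simple module generated by a highest
   weight vector of weight lambda. As sigma may act on that vector by 1 or
   by -1, this determines V(lambda) only up to a parity shift. *)
Definition is_V (N : V -> Prop) (lambda : wt) : Prop :=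
  exists v, is_simple_hw N lambda v.

End HighestWeight.

(* Main.v *)
From HB Require Import structures.
From mathcomp Require Import all_boot all_order all_algebra.
From mathcomp Require Import finmap boolp ring zify.
From mathcomp.multinomials Require Import monalg.
Require Import Defs.

(** Write [mon a] for the basis monomial of exponent [a], read as zero when [a]
is out of range.  Every coordinate [i] carries a raising operator, sending
[mon a] to [[a_i + 1] mon (a + eps_i)], and a lowering operator, sending [mon a]
to [mon (a - eps_i)]; both are called [osc].  Oscillators at different
coordinates commute.  The operators [x_i] and [d_i] of the module are these
oscillators multiplied by signs and powers of [q] that depend on the entries
below [i] ([twist]), as in a Jordan-Wigner transformation.  In the products
giving [E_j] and [F_j] these factors cancel: [E_j] raises the lower index of the
node and lowers the upper one, and [F_j] does the opposite ([node],
[node_natural_E], [node_natural_F]).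

So each defining relation reduces to identities in a single coordinate.  In
[I_0] an oscillator squares to zero ([osc_nil]).  In [I_1] raising after
lowering is multiplication by [[a_i]] and lowering after raising is
multiplication by [[a_i + 1]], whence a Serre relation ([osc_serre]) from the
three-term recursion of the quantum integers.  Truncating the exponents at [l]
changes nothing in this, because the coefficient that would leave the range is
[[l] = 0].  The quartic relation at the odd node is the Serre relation of the first [I_1]
coordinate, the words that do not vanish having a common factor in the other
coordinates ([node_quartic]).

For simplicity, [E_j] translates exponents by the simple root of [j], with
coefficient [[a_lo + 1]]; under the assumption on [q] it is nonzero whenever the
target is in range.  An exponent that no simple root can raise is obtained by
filling the coordinates one after the other, hence is determined by its degree
([extremal_unique]).  Therefore every monomial of degree [t] is raised by a
product of [E_j]'s to a nonzero multiple of the extremal monomial [mon l], and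
the [F_j]'s lead back along the same path ([linked_extremal]).  The height
[sum i a_i] drops by one at each raising, so [l] is the only exponent of least
height in its degree.  Given [v <> 0] in a submodule, let [b] have the greatest
height in the support of [v].  The product raising [b] to [l] sends any other
[mon b'] of the support to a multiple of [mon (b' + l - b)], whose height is at
most that of [l]; it is therefore out of range, and [v] goes to a nonzero
multiple of [mon l], which generates everything ([simple_extremal]).  The torus
does not enter this argument: the same proof serves [gl] and [sl], and weight
spaces need not be told apart when [q] is a root of unity. *)

Set Implicit Arguments.
Unset Strict Implicit.
Unset Printing Implicit Defensive.

Import Order.TTheory GRing.Theory Num.Theory.
Local Open Scope ring_scope.

(** * Linear extension from a basis *)

Section FreeModule.
Variables (K : comNzRingType) (T : choiceType).

(** The linear map with prescribed values on the basis [<< k >>]; its shape is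
that of [lin_ext]. *)
Definition malg_lift (V : lmodType K) (f : T -> V) (x : {malg K[T]}) : V :=
  \sum_(k <- msupp x) x@_k *: f k.

Lemma malg_liftEw (V : lmodType K) (f : T -> V) (x : {malg K[T]})
    (d : {fset T}) :
  (msupp x `<=` d)%fset -> malg_lift f x = \sum_(k <- d) x@_k *: f k.
Proof.
move=> le_xd; apply/big_fset_incl => // k _ /mcoeff_outdom ->.
exact: scale0r.
Qed.

Fact malg_lift_is_linear (V : lmodType K) (f : T -> V) :
  linear (malg_lift f).
Proof.
move=> c x y; pose d := (msupp x `|` msupp y)%fset.
have xd : (msupp x `<=` d)%fset := fsubsetUl _ _.
have yd : (msupp y `<=` d)%fset := fsubsetUr _ _.
have cxyd : (msupp (c *: x + y) `<=` d)%fset.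
  exact: fsubset_trans (msuppD_le _ _) (fsetSU _ (msuppZ_le _ _)).
rewrite !(malg_liftEw _ (d := d)) // scaler_sumr -big_split /=.
by apply: eq_bigr => k _; rewrite mcoeffD mcoeffZ scalerDl scalerA.
Qed.
HB.instance Definition _ (V : lmodType K) (f : T -> V) :=
  GRing.isLinear.Build K {malg K[T]} V _ (malg_lift f)
    (malg_lift_is_linear f).

Lemma malg_liftU (V : lmodType K) (f : T -> V) k : malg_lift f << k >> = f k.
Proof.
by rewrite (malg_liftEw _ (msuppU_le)) big_seq_fset1 mcoeffUU scale1r.
Qed.

Lemma malgU_scale (c : K) (k : T) : << c *g k >> = c *: << k >> :> {malg K[T]}.
Proof. by apply/malgP => k'; rewrite mcoeffZ !mcoeffU mulrnAr mulr1. Qed.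

Lemma malg_sumE (x : {malg K[T]}) : x = \sum_(k <- msupp x) x@_k *: << k >>.
Proof.
by rewrite {1}[x]monalgE; apply: eq_bigr => k _; rewrite malgU_scale.
Qed.

Lemma malg_lift_eq (V : lmodType K) (f g : {linear {malg K[T]} -> V}) :
  (forall k, f << k >> = g << k >>) -> f =1 g.
Proof.
move=> fg x; rewrite [x]malg_sumE !linear_sum; apply: eq_bigr => k _.
by rewrite !linearZ fg.
Qed.
End FreeModule.

(** * Representations of a presented algebra *)

Section PresentedAction.
Variables (K : comNzRingType) (T : choiceType) (V : lmodType K).
Variable op : T -> {linear V -> V}.

Local Notation free := {malg K[{fmonom T}]}.

Definition word_act (w : {fmonom T}) : V -> V :=
  foldr (fun x f => op x \o f) id w.

Fact word_act_is_linear w : linear (word_act w).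
Proof.
rewrite /word_act; case: w => s c u v /=.
by elim: s => //= x s IHs; rewrite IHs linearP.
Qed.
HB.instance Definition _ w :=
  GRing.isLinear.Build K V V _ (word_act w) (word_act_is_linear w).

Lemma word_act1 v : word_act mone v = v.
Proof. by rewrite /word_act fm1. Qed.

Lemma word_actM w w' v : word_act (mmul w w') v = word_act w (word_act w' v).
Proof. by rewrite /word_act fmM foldr_cat; elim: (w : seq T) => //= x s ->. Qed.

Definition free_act (x : free) (v : V) : V := malg_lift (word_act^~ v) x.

Fact free_act_is_linear x : linear (free_act x).
Proof.
move=> c u v; rewrite /free_act /malg_lift scaler_sumr -big_split /=.
apply: eq_bigr => w _.
by rewrite word_act_is_linear scalerDr !scalerA mulrC.
Qed.
HB.instance Definition _ x :=
  GRing.isLinear.Build K V V _ (free_act x) (free_act_is_linear x).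

Lemma free_actD x y v : free_act (x + y) v = free_act x v + free_act y v.
Proof. exact: linearD. Qed.
Lemma free_actN x v : free_act (- x) v = - free_act x v.
Proof. exact: linearN. Qed.
Lemma free_actB x y v : free_act (x - y) v = free_act x v - free_act y v.
Proof. exact: linearB. Qed.
Lemma free_actZ c x v : free_act (c *: x) v = c *: free_act x v.
Proof. exact: linearZ. Qed.
Lemma free_act0 v : free_act 0 v = 0.
Proof. exact: linear0. Qed.
Lemma free_act1 v : free_act 1 v = v.
Proof. by rewrite /free_act malg_liftU word_act1. Qed.

Lemma free_act_gen x v : free_act << fmu x >> v = op x v.
Proof. by rewrite /free_act malg_liftU /word_act fmuE. Qed.

Lemma free_actM x y v : free_act (x * y) v = free_act x (free_act y v).
Proof.
have UM w z : free_act (<< w >> * z) v = word_act w (free_act z v).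
  rewrite malgM_def fgmulUg /free_act linear_sum /malg_lift /=.
  rewrite linear_sum; apply: eq_bigr => k _.
  rewrite linearZ /= -word_actM.
  by rewrite mul1r malgU_scale linearZ /= malg_liftU.
rewrite /free_act [x in RHS]malg_sumE [x in LHS]malg_sumE mulr_suml.
rewrite !linear_sum /=; apply: eq_bigr => k _.
by rewrite -scalerAl !linearZ /= malg_liftU -UM.
Qed.

Lemma free_actX x k v : free_act (x ^+ k) v = iter k (free_act x) v.
Proof.
by elim: k => [|k IHk]; rewrite ?expr0 ?free_act1 // exprS free_actM IHk.
Qed.

Variable R : free -> free -> Prop.
Hypothesis opR : forall l r, R l r -> forall v, free_act l v = free_act r v.

(** The annihilator of [V] is a two-sided ideal, so it contains the ideal
generated by the relations as soon as it contains the relations. *)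
Lemma free_act_ideal x : ideal_gen R x -> forall v, free_act x v = 0.
Proof.
elim=> {x} [l r Rlr||x y _ Ix _ Iy|a x _ IH|a x _ IH] v.
- by rewrite free_actB (opR Rlr) subrr.
- exact: free_act0.
- by rewrite free_actB Ix Iy subrr.
- by rewrite free_actM IH linear0.
by rewrite free_actM IH.
Qed.

(** Any representative may be chosen, by [presented_act_pi]. *)
Definition presented_act (u : presented R) (v : V) : V :=
  free_act (presented_repr u) v.

Lemma presented_act_pi x v : presented_act (presented_pi R x) v = free_act x v.
Proof.
apply/eqP; rewrite -subr_eq0 -free_actB; apply/eqP.
apply: free_act_ideal; apply/in_idealP/presented_eqP.
exact: presented_reprK.
Qed.

Lemma presented_act_is_action : is_action presented_act.
Proof.
split.
- move=> v c; elim/presented_ind=> x; elim/presented_ind=> y.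
  rewrite {1}/GRing.scale /= presented_piZ -presented_piD !presented_act_pi.
  by rewrite free_actD free_actZ.
- by move=> u c v w; rewrite /presented_act linearP.
- by move=> v; rewrite [1]/(presented_pi R 1) presented_act_pi free_act1.
elim/presented_ind=> x; elim/presented_ind=> y v.
by rewrite [_ * _]presented_piM !presented_act_pi free_actM.
Qed.

Lemma presented_act_invariant (P : V -> Prop) :
  P 0 -> (forall v w, P v -> P w -> P (v + w)) ->
  (forall c v, P v -> P (c *: v)) -> (forall x v, P v -> P (op x v)) ->
  is_submodule presented_act P.
Proof.
move=> P0 PD PZ Pop; split=> //.
move=> u v Pv; rewrite /presented_act /free_act /malg_lift.
elim/big_ind: _ => // w _; apply: PZ; rewrite /word_act.
by elim: (w : seq T) => //= x s; apply: Pop.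
Qed.
End PresentedAction.

(** * Exponents and weights *)

Section Weights.
Variables (m n : nat) (r : option nat).

Local Notation wt := {ffun 'I_(m + n) -> int}.
Local Notation adm := (@admissible m n r).

Lemma epsE (i k : 'I_(m + n)) : (eps i : wt) k = (k == i)%:R.
Proof. by rewrite ffunE -val_eqE /=; case: eqP. Qed.

Lemma epsii (i : 'I_(m + n)) : (eps i : wt) i = 1.
Proof. by rewrite epsE eqxx. Qed.

Lemma wtD (a b : wt) i : (a + b) i = a i + b i.
Proof. by rewrite ffunE. Qed.

Lemma wtN (a : wt) i : (- a) i = - a i.
Proof. by rewrite ffunE. Qed.

Lemma wtB (a b : wt) i : (a - b) i = a i - b i.
Proof. by rewrite wtD wtN. Qed.

Lemma wtMn (a : wt) k i : (a *+ k) i = a i *+ k.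
Proof. by elim: k => [|k IHk]; rewrite ?mulr0n ?ffunE // !mulrS wtD IHk. Qed.

Lemma lo_neq_hi (j : 'I_(m + n).-1) : lo j != hi j.
Proof. by rewrite -val_eqE /= neq_ltn ltnSn. Qed.

Definition root (j : 'I_(m + n).-1) : wt := eps (lo j) - eps (hi j).

Definition node_shift (up : bool) (j : 'I_(m + n).-1) : wt :=
  if up then root j else - root j.

Lemma root_lo j : root j (lo j) = 1.
Proof. by rewrite /root wtB epsii epsE (negbTE (lo_neq_hi j)) subr0. Qed.

Lemma root_hi j : root j (hi j) = -1.
Proof.
by rewrite /root wtB epsii epsE eq_sym (negbTE (lo_neq_hi j)) sub0r.
Qed.

Lemma degreeD (a b : wt) : degree (a + b) = degree a + degree b.
Proof. by rewrite /degree -big_split; apply: eq_bigr => i _; rewrite wtD. Qed.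

Lemma degreeN (a : wt) : degree (- a) = - degree a.
Proof. by rewrite /degree -sumrN; apply: eq_bigr => i _; rewrite wtN. Qed.

Lemma degree_eps (i : 'I_(m + n)) : degree (eps i : wt) = 1.
Proof.
rewrite /degree (bigD1 i) //= epsii big1 ?addr0 // => k ki.
by rewrite epsE (negbTE ki).
Qed.

Lemma degree_node_shift up j : degree (node_shift up j) = 0.
Proof.
by rewrite /node_shift /root; case: up; rewrite ?degreeN degreeD degreeN;
  rewrite !degree_eps.
Qed.

Lemma part1D (a b : wt) : part1 (a + b) = part1 a + part1 b.
Proof. by apply/ffunP => i; rewrite !ffunE; case: ifP. Qed.

Lemma part1N (a : wt) : part1 (- a) = - part1 a.
Proof. by apply/ffunP => i; rewrite !ffunE; case: ifP. Qed.

Lemma part1_eps (i : 'I_(m + n)) :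
  part1 (eps i : wt) = if (i < m)%N then 0 else eps i.
Proof.
apply/ffunP => k; rewrite ffunE epsE; have [->|ki] := eqVneq k i.
  by case: ifP => _; rewrite ?ffunE ?eqxx.
case: ifP => _; case: ifP => _; rewrite ?epsE ?(negbTE ki) //; by rewrite ffunE.
Qed.

Lemma formDl (a b c : wt) : form (a + b) c = form a c + form b c.
Proof.
rewrite /form -big_split /=; apply: eq_bigr => i _; rewrite wtD.
by case: ifP => _; ring.
Qed.

Lemma formNl (a c : wt) : form (- a) c = - form a c.
Proof.
rewrite /form -sumrN; apply: eq_bigr => i _; rewrite wtN.
by case: ifP => _; ring.
Qed.

Lemma form_sym (a b : wt) : form a b = form b a.
Proof. by apply: eq_bigr => i _; rewrite !(mulrC (a i)). Qed.

Lemma form_eps (a : wt) (i : 'I_(m + n)) :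
  form a (eps i) = if (i < m)%N then a i else - a i.
Proof.
rewrite /form (bigD1 i) //= epsii mulr1 big1 ?addr0 // => k ki.
by rewrite epsE (negbTE ki) mulr0 oppr0 if_same.
Qed.

Lemma form_root (a : wt) j :
  form a (root j) = form a (eps (lo j)) - form a (eps (hi j)).
Proof. by rewrite form_sym formDl formNl !(form_sym a). Qed.

Lemma starE (i : 'I_(m + n)) (b : wt) :
  star (eps i) b = \sum_(k < m + n | (k < i)%N) b k.
Proof.
rewrite /star (bigD1 i) //= [X in _ + X]big1 ?addr0.
  by apply: eq_bigr => k _; rewrite epsii mul1r.
move=> k ki; rewrite big1 // => k' _.
by rewrite epsE (negbTE ki) mul0r.
Qed.

Lemma star_hi (j : 'I_(m + n).-1) (b : wt) :
  star (eps (hi j)) b = star (eps (lo j)) b + b (lo j).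
Proof.
rewrite !starE (bigD1 (lo j)) //= addrC; congr (_ + _).
apply: eq_bigl => k; rewrite -val_eqE /= ltnS; lia.
Qed.

Lemma star_part1_le (i : 'I_(m + n)) (a : wt) :
  (i <= m)%N -> star (eps i) (part1 a) = 0.
Proof.
move=> im; rewrite starE big1 // => k ki.
by rewrite ffunE (leq_trans ki im).
Qed.

Definition osc_sign (up : bool) : int := if up then 1 else -1.

Definition osc_shift (up : bool) (i : 'I_(m + n)) : wt :=
  if up then eps i else - eps i.

Lemma osc_shift_at up i (a : wt) :
  (a + osc_shift up i) i = a i + osc_sign up.
Proof. by rewrite /osc_shift wtD; case: up; rewrite ?wtN epsE eqxx. Qed.

Lemma osc_shift_ne up i k (a : wt) :
  k != i -> (a + osc_shift up i) k = a k.
Proof.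
move=> /negbTE ki; rewrite /osc_shift wtD.
by case: up; rewrite ?wtN epsE ki ?oppr0 addr0.
Qed.

(** The condition that [admissible] puts on a single entry. *)
Definition in_range (i : 'I_(m + n)) (x : int) : bool :=
  (0 <= x) && (if (i < m)%N then x <= 1
               else if r is Some l then x < l%:Z else true).

Lemma admP (a : wt) : reflect (forall i, in_range i (a i)) (adm a).
Proof. exact: (@forallP _ (fun i => in_range i (a i))). Qed.

Lemma adm_at i (a : wt) : adm a -> in_range i (a i).
Proof. by move/admP. Qed.

Lemma adm_shift up i (a : wt) :
  adm a -> adm (a + osc_shift up i) = in_range i (a i + osc_sign up).
Proof.
move=> /admP Aa; apply/admP/idP => [/(_ i)|Ai k]; first by rewrite osc_shift_at.
have [->|ki] := eqVneq k i; first by rewrite osc_shift_at.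
by rewrite osc_shift_ne.
Qed.

(** Raising moves one unit of the exponent one place to the left, so the height
bounds the number of raisings still possible. *)
Definition height (a : wt) : int := \sum_(i < m + n) i%:Z * a i.

Lemma heightD (a b : wt) : height (a + b) = height a + height b.
Proof.
by rewrite /height -big_split; apply: eq_bigr => i _; rewrite wtD mulrDr.
Qed.

Lemma heightN (a : wt) : height (- a) = - height a.
Proof. by rewrite /height -sumrN; apply: eq_bigr => i _; rewrite wtN mulrN. Qed.

Lemma height_eps (i : 'I_(m + n)) : height (eps i) = i.
Proof.
rewrite /height (bigD1 i) //= epsii mulr1 big1 ?addr0 // => k ki.
by rewrite epsE (negbTE ki) mulr0.
Qed.

Lemma height_root j : height (root j) = -1.
Proof.
rewrite /root heightD heightN (height_eps (lo j)) (height_eps (hi j)) /=; lia.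
Qed.

Lemma height_ge0 (a : wt) : adm a -> 0 <= height a.
Proof.
move=> Aa; apply: sumr_ge0 => i _; apply: mulr_ge0 => //.
by have /andP[] := adm_at i Aa.
Qed.

(** Raising [lo j] cannot push it below zero and lowering [hi j] cannot push it
above its bound, so only one bound of each entry has to be tested. *)
Lemma adm_root j (a : wt) : adm a ->
  adm (a + root j) = in_range (lo j) (a (lo j) + 1) && (0 < a (hi j)).
Proof.
move=> Aa; apply/idP/andP => [Ar|[rl rh]].
  have := adm_at (lo j) Ar; rewrite wtD root_lo => ->; split=> //.
  have /andP[] := adm_at (hi j) Ar; rewrite wtD root_hi; lia.
apply/admP => k; rewrite /root addrA.
have [->|kl] := eqVneq k (lo j).
  by rewrite wtB wtD epsii epsE (negbTE (lo_neq_hi j)) subr0.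
have [->|kh] := eqVneq k (hi j).
  rewrite wtB wtD epsii epsE eq_sym (negbTE (lo_neq_hi j)) addr0.
  have := adm_at (hi j) Aa; rewrite /in_range; case: ifP => _.
    by move: rh; lia.
  by case: r => [l|]; move: rh; lia.
by rewrite wtB wtD !epsE (negbTE kl) (negbTE kh) addr0 subr0; apply: adm_at.
Qed.

Definition extremal (a : wt) : Prop :=
  adm a /\ forall j, ~~ adm (a + root j).

Hypothesis r_gt1 : forall l, r = Some l -> (1 < l)%N.

(** If the entry [i] is not full then the next one must vanish, since otherwise
the root between them could be added.  A vanishing entry is not full either, so
the argument propagates to all later entries. *)
Lemma extremal_tail a (i k : 'I_(m + n)) :
  extremal a -> in_range i (a i + 1) -> (i < k)%N -> a k = 0.
Proof.
case=> Aa top ri; case: k => k kmn /=; elim: k kmn => // k IHk kmn.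
rewrite ltnS leq_eqVlt => ik.
have kmn' : (k < (m + n).-1)%N by lia.
pose j : 'I_(m + n).-1 := Ordinal kmn'.
have -> : Ordinal kmn = hi j by apply: val_inj.
suff rl : in_range (lo j) (a (lo j) + 1).
  have := top j; rewrite adm_root // rl /= => ah.
  by have /andP[] := adm_at (hi j) Aa; move: ah; lia.
case/orP: ik => [/eqP ik|ik].
  by have -> : lo j = i by apply: val_inj.
have -> : a (lo j) = 0.
  have -> : lo j = Ordinal (ltnW kmn) by apply: val_inj.
  exact: IHk.
rewrite /in_range add0r; case: ifP => _ //.
by move: r_gt1; case: r => [l /(_ l erefl)|//]; lia.
Qed.

(** Suppose [c_i < d_i].  Then [c_i] is not full, so [c] vanishes after [i].
Before [i] no entry of [d] is smaller than that of [c]: it would not be full and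
would force [d_i = 0].  Hence [c <= d] entrywise, with strict inequality at [i],
and the degrees differ. *)
Lemma extremal_unique a b :
  extremal a -> extremal b -> degree a = degree b -> a = b.
Proof.
have ltF c d (i : 'I_(m + n)) :
    extremal c -> extremal d -> degree c = degree d -> ~~ (c i < d i).
  move=> Tc Td dcd; apply/negP => cd; have [Ac _] := Tc; have [Ad _] := Td.
  have ri : in_range i (c i + 1).
    have := adm_at i Ac; have := adm_at i Ad; rewrite /in_range.
    by case: r => [l|]; case: ifP => _; move: cd; lia.
  suff : degree c < degree d by rewrite dcd ltxx.
  rewrite /degree (bigD1 i) //= [ltRHS](bigD1 i) //=.
  apply: ltr_leD => //; apply: ler_sum => k ki.
  have [ik|] := ltnP i k.
    by rewrite (extremal_tail Tc ri ik); have /andP[] := adm_at k Ad.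
  rewrite leq_eqVlt val_eqE (negbTE ki) /= => lki.
  rewrite leNgt; apply/negP => dc.
  have rk : in_range k (d k + 1).
    have := adm_at k Ac; have := adm_at k Ad; rewrite /in_range.
    by case: r => [l|]; case: ifP => _; move: dc; lia.
  have := extremal_tail Td rk lki; move: cd.
  by have /andP[] := adm_at i Ac; lia.
move=> Ta Tb dab; apply/ffunP => i.
by apply/eqP; rewrite eq_le !leNgt ltF //= ltF.
Qed.

(** The form in which extremality can be read off the highest weights; the entry
at [p] may be any value in range. *)
Lemma extremal_shape a (p : nat) : adm a ->
  (forall i : 'I_(m + n), (i < p)%N -> ~~ in_range i (a i + 1)) ->
  (forall i : 'I_(m + n), (p < i)%N -> a i = 0) -> extremal a.
Proof.
move=> Aa full empty; split=> // j; rewrite adm_root // negb_and.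
have [jp|jp] := ltnP (lo j) p; first by rewrite full.
by rewrite [a (hi j)]empty ?ltxx ?orbT // ltnS.
Qed.

End Weights.

(** * Quantum integers *)

Section QNumbers.
Variables (K : fieldType) (q : K).
Hypotheses (q_neq0 : q != 0) (q2_neq1 : q ^+ 2 != 1).

Local Notation "[ x ]q" := (qnum q x) (at level 0, x at level 99).

Lemma qB_neq0 : q - q^-1 != 0.
Proof.
apply: contra q2_neq1; rewrite subr_eq0 => /eqP q1.
by rewrite expr2 {2}q1 divff.
Qed.

Lemma qnum0 : [0]q = 0.
Proof. by rewrite /qnum oppr0 subrr mul0r. Qed.

Lemma qqB1_neq0 : q * q - 1 != 0.
Proof. by rewrite subr_eq0 -expr2. Qed.

Lemma qnum1 : [1]q = 1.
Proof. by rewrite /qnum expr1z exprN1 divff ?qB_neq0. Qed.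

(** The scalar form of the Serre relation. *)
Lemma qnum_rec x : [x]q - (q + q^-1) * [x + 1]q + [x + 1 + 1]q = 0.
Proof.
rewrite /qnum !opprD !expfzDr // -!invr_expz !expr1z.
have qx : q ^ x != 0 by rewrite expfz_neq0.
by field; rewrite q_neq0 qx qqB1_neq0.
Qed.

(** This and the two identities that follow are the commutator of [E_j] and
[F_j], according to the parities of the two indices of the node: both in [I_0],
both in [I_1], then one in each. *)
Lemma qnum_bracket00 x y : [x]q * [1 - y]q - [1 - x]q * [y]q = [x - y]q.
Proof.
rewrite /qnum !opprD !opprK !expfzDr // -!invr_expz !expr1z.
have qx : q ^ x != 0 by rewrite expfz_neq0.
have qy : q ^ y != 0 by rewrite expfz_neq0.
by field; rewrite q_neq0 qx qy qqB1_neq0.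
Qed.

Lemma qnum_bracket11 x y : [x]q * [y + 1]q - [x + 1]q * [y]q = [x - y]q.
Proof.
rewrite /qnum !opprD !opprK !expfzDr // -!invr_expz !expr1z.
have qx : q ^ x != 0 by rewrite expfz_neq0.
have qy : q ^ y != 0 by rewrite expfz_neq0.
by field; rewrite q_neq0 qx qy qqB1_neq0.
Qed.

Lemma qnum_bracket01 x y : [x]q * [y + 1]q + [1 - x]q * [y]q = [x + y]q.
Proof.
rewrite /qnum !opprD !opprK !expfzDr // -!invr_expz !expr1z.
have qx : q ^ x != 0 by rewrite expfz_neq0.
have qy : q ^ y != 0 by rewrite expfz_neq0.
by field; rewrite q_neq0 qx qy qqB1_neq0.
Qed.

Lemma qchar_eq0 : qchar q = 0%N -> forall s : nat, (0 < s)%N -> qnum q s != 0.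
Proof.
rewrite /qchar; case: pselect => [ex|nex _ s s0].
  by case: ex_minnP => s /andP[+ _] _ s0; rewrite s0.
by apply/negP => qs; apply: nex; exists s; rewrite s0.
Qed.

Lemma qchar_gt0 l : qchar q = l -> (0 < l)%N -> qnum q l%:Z = 0 /\
  forall s : nat, (0 < s < l)%N -> qnum q s != 0.
Proof.
rewrite /qchar; case: pselect => [ex|nex <- //].
case: ex_minnP => k /andP[_ /eqP qk] kmin <- _; split=> // s /andP[s0 sk].
by apply/negP => qs; move: sk; rewrite ltnNge kmin // s0.
Qed.

End QNumbers.

(** * Oscillators *)

Section FockModel.

Variables (K : fieldType) (q : K) (m n : nat) (r : option nat).

Hypotheses (q_neq0 : q != 0) (q2_neq1 : q ^+ 2 != 1).

Hypothesis r_gt1 : forall l, r = Some l -> (1 < l)%N.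
Hypothesis qnum_r : forall l, r = Some l -> qnum q l%:Z = 0.

Local Notation wt := {ffun 'I_(m + n) -> int}.
Local Notation adm := (@admissible m n r).
Local Notation "[ x ]q" := (qnum q x) (at level 0, x at level 99).

(** The space is kept abstract: it is spanned by vectors [mon a], and [lext f]
is the linear map sending [mon a] to [f a] for [a] in range.  The relations
depend on nothing else. *)
Variables (V : lmodType K) (mon : wt -> V).
Variable lext : (wt -> V) -> {linear V -> V}.
Hypothesis mon_out : forall a, ~~ adm a -> mon a = 0.
Hypothesis lext_mon : forall f a, adm a -> lext f (mon a) = f a.
Hypothesis mon_ext : forall f g : {linear V -> V},
  (forall a, adm a -> f (mon a) = g (mon a)) -> f =1 g.

Definition osc_coef (up : bool) (i : 'I_(m + n)) (a : wt) : K :=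
  if up then [a i + 1]q else 1.

Definition osc (up : bool) (i : 'I_(m + n)) : V -> V :=
  lext (fun a => osc_coef up i a *: mon (a + osc_shift up i)).

HB.instance Definition _ up i := GRing.Linear.on (osc up i).

Lemma oscZ up i c v : osc up i (c *: v) = c *: osc up i v.
Proof. exact: linearZ. Qed.

Lemma osc_mon up i a :
  adm a -> osc up i (mon a) = osc_coef up i a *: mon (a + osc_shift up i).
Proof. by move=> Aa; rewrite /osc lext_mon. Qed.

(** The intermediate exponent may be out of range even though [a] is not; the
final one is then out of range too, because the entry [k] is the same in
both. *)
Lemma osc_mon_shift up i up' k a : i != k -> adm a ->
  osc up i (mon (a + osc_shift up' k)) =
  osc_coef up i a *: mon (a + osc_shift up i + osc_shift up' k).
Proof.
move=> ik Aa; have ki : k != i by rewrite eq_sym.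
have [Aa'|Na] := boolP (adm (a + osc_shift up' k)).
  by rewrite osc_mon // addrAC /osc_coef osc_shift_ne.
rewrite mon_out // linear0 mon_out ?scaler0 //.
apply: contra Na; rewrite (adm_shift _ _ Aa) => /admP/(_ k).
by rewrite osc_shift_at osc_shift_ne.
Qed.

Lemma osc_comm up up' i k v :
  i != k -> osc up i (osc up' k v) = osc up' k (osc up i v).
Proof.
move=> ik; pose f : {linear V -> V} := osc up i \o osc up' k.
pose g : {linear V -> V} := osc up' k \o osc up i.
apply: (mon_ext (f := f) (g := g)) => a Aa /=.
rewrite (osc_mon up') // (osc_mon up) // !linearZ /=.
have ki : k != i by rewrite eq_sym.
by rewrite !osc_mon_shift // !scalerA mulrC (addrAC a).
Qed.

Lemma osc_comm_same up i k v :
  osc up i (osc up k v) = osc up k (osc up i v).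
Proof. by have [->//|ik] := eqVneq i k; apply: osc_comm. Qed.

(** When the lowering leaves the range, [a_i = 0] and the coefficient
vanishes. *)
Lemma osc_up_dn i a : osc true i (osc false i (mon a)) = [a i]q *: mon a.
Proof.
have [Aa|Aa] := boolP (adm a); last by rewrite mon_out // !linear0.
rewrite osc_mon // scale1r; have [Aa'|] := boolP (adm (a + osc_shift false i)).
  by rewrite osc_mon // /osc_coef osc_shift_at !subrK.
move=> Na; rewrite mon_out // linear0; suff -> : a i = 0.
  by rewrite qnum0 scale0r.
move: Na; rewrite adm_shift //; have := adm_at i Aa; rewrite /in_range /=.
by case: r => [l|]; case: ifP => _; lia.
Qed.

(** When the raising leaves the range, either [a_i = 1] in [I_0] or
[a_i + 1 = l] in [I_1], and the coefficient vanishes. *)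
Lemma osc_dn_up i a : osc false i (osc true i (mon a)) =
  [if (i < m)%N then 1 - a i else a i + 1]q *: mon a.
Proof.
have [Aa|Aa] := boolP (adm a); last by rewrite mon_out // !linear0.
rewrite osc_mon // linearZ /=; have := adm_at i Aa.
have [Aa'|] := boolP (adm (a + osc_shift true i)).
  rewrite osc_mon // scale1r addrK; move: Aa'.
  rewrite adm_shift // /in_range /=.
  case: ifP => // im H1 H2; congr ([_]q *: _); move: H1 H2; lia.
move=> Na; rewrite mon_out // linear0 scaler0.
move: Na; rewrite adm_shift // /in_range /=; case: ifP => im Na Aai.
  by have -> : 1 - a i = 0; [move: Na Aai; lia | rewrite qnum0 scale0r].
case rE: r Na Aai => [l|] Na Aai; last by move: Na Aai; lia.
have -> : a i + 1 = l by move: Na Aai; lia.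
by rewrite qnum_r // scale0r.
Qed.

Lemma osc_mon_scalar up i a :
  exists c, osc up i (mon a) = c *: mon (a + osc_shift up i).
Proof.
have [Aa|Na] := boolP (adm a).
  by exists (osc_coef up i a); apply: osc_mon.
by exists 0; rewrite mon_out // linear0 scale0r.
Qed.

(** Two equal moves leave [{0, 1}]. *)
Lemma osc_nil up (i : 'I_(m + n)) v : (i < m)%N -> osc up i (osc up i v) = 0.
Proof.
move=> im; pose f : {linear V -> V} := osc up i \o osc up i.
apply: (mon_ext (f := f) (g := \0)) => a Aa /=.
rewrite osc_mon // linearZ /=.
have [c ->] := osc_mon_scalar up i (a + osc_shift up i).
rewrite [mon _]mon_out ?scaler0 //; apply/admP => /(_ i).
rewrite !osc_shift_at; have := adm_at i Aa; rewrite /in_range im.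
by case: up {f}; rewrite /osc_sign; lia.
Qed.

(** By [osc_up_dn] and [osc_dn_up] the three terms are proportional to
[osc up i (mon a)], with three consecutive quantum integers as coefficients. *)
Lemma osc_serre up (i : 'I_(m + n)) v : (m <= i)%N ->
  osc up i (osc up i (osc (~~ up) i v))
  - (q + q^-1) *: osc up i (osc (~~ up) i (osc up i v))
  + osc (~~ up) i (osc up i (osc up i v)) = 0.
Proof.
move=> mi; have im : (i < m)%N = false by rewrite ltnNge mi.
pose f1 : {linear V -> V} := osc up i \o (osc up i \o osc (~~ up) i).
pose f2 : {linear V -> V} := osc up i \o (osc (~~ up) i \o osc up i).
pose f3 : {linear V -> V} := osc (~~ up) i \o (osc up i \o osc up i).
pose f : {linear V -> V} := (f1 \+ ((- (q + q^-1)) \*: f2)) \+ f3.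
suff /(_ v) : f =1 \0 by rewrite /= scaleNr.
apply: mon_ext => a Aa /=; rewrite scaleNr; case: up {f f3 f2 f1} => /=.
  rewrite osc_up_dn osc_dn_up im !linearZ /= (osc_mon true _ Aa) !linearZ /=.
  rewrite osc_dn_up im wtD epsii !scalerN !scalerA -scalerBl -scalerDl.
  rewrite [X in X *: _](_ : _ = osc_coef true i a *
    ([a i]q - (q + q^-1) * [a i + 1]q + [a i + 1 + 1]q)).
    by rewrite qnum_rec // mulr0 scale0r.
  by rewrite /osc_coef; ring.
rewrite osc_up_dn osc_dn_up im !linearZ /= (osc_mon false _ Aa) !linearZ /=.
rewrite osc_up_dn wtB epsii !scalerN !scalerA -scalerBl -scalerDl.
rewrite [X in X *: _](_ : _ = osc_coef false i a *
    ([a i - 1]q - (q + q^-1) * [a i - 1 + 1]q + [a i - 1 + 1 + 1]q)).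
  by rewrite qnum_rec // mulr0 scale0r.
by rewrite !subrK /=; ring.
Qed.

(** The torus and the parity act through such diagonal operators. *)
Definition diag (f : wt -> K) : V -> V := lext (fun a => f a *: mon a).

HB.instance Definition _ f := GRing.Linear.on (diag f).

Lemma diagZ f c v : diag f (c *: v) = c *: diag f v.
Proof. exact: linearZ. Qed.

Lemma diag_mon f a : diag f (mon a) = f a *: mon a.
Proof.
have [Aa|Na] := boolP (adm a); first exact: lext_mon.
by rewrite mon_out // !linear0.
Qed.

Lemma eq_diag f f' v : f =1 f' -> diag f v = diag f' v.
Proof.
move=> ff; apply: (mon_ext (f := diag f) (g := diag f')) => a _ /=.
by rewrite !diag_mon ff.
Qed.

Lemma diag_scalar c f v : (forall a, f a = c) -> diag f v = c *: v.
Proof.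
move=> fc; pose g : {linear V -> V} := c \*: idfun.
suff /(_ v) : diag f =1 g by [].
by apply: mon_ext => a Aa /=; rewrite diag_mon fc.
Qed.

Lemma diag1 f v : (forall a, f a = 1) -> diag f v = v.
Proof. by move/diag_scalar->; rewrite scale1r. Qed.

Lemma diag_comp f g v : diag f (diag g v) = diag (fun a => f a * g a) v.
Proof.
pose h : {linear V -> V} := diag f \o diag g.
apply: (mon_ext (f := h)) => a Aa /=.
by rewrite !diag_mon linearZ /= diag_mon scalerA mulrC.
Qed.

Lemma iter_diag f k v : iter k (diag f) v = diag (fun a => f a ^+ k) v.
Proof.
elim: k => [|k IHk] /=; first by rewrite diag1.
by rewrite IHk diag_comp; apply: eq_diag => a; rewrite exprS.
Qed.

(** * The operators attached to the nodes of the Dynkin diagram *)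

(** [E_j] is [node true j] and [F_j] is [node false j], so that a relation for
the [E_j] and its analogue for the [F_j] have a single proof. *)
Definition node (up : bool) (j : 'I_(m + n).-1) : V -> V :=
  osc up (lo j) \o osc (~~ up) (hi j).

HB.instance Definition _ up j := GRing.Linear.on (node up j).

Lemma node_mon up j a : adm a -> node up j (mon a) =
  [a (if up then lo j else hi j) + 1]q *: mon (a + node_shift up j).
Proof.
move=> Aa; have lh := lo_neq_hi j; have hl : hi j != lo j by rewrite eq_sym.
rewrite /node /= osc_mon // linearZ /= osc_mon_shift // scalerA -addrA.
rewrite /osc_coef /node_shift /root /osc_shift; case: up => /=.
  by rewrite mul1r.
by rewrite mulr1 opprB [eps _ - _]addrC.
Qed.

Lemma node_mon_scalar up j a :
  exists c, node up j (mon a) = c *: mon (a + node_shift up j).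
Proof.
have [Aa|Na] := boolP (adm a); last first.
  by exists 0; rewrite mon_out // linear0 scale0r.
by rewrite node_mon //; eexists.
Qed.

Lemma diag_node f c up j v :
  (forall a, f (a + node_shift up j) = c * f a) ->
  diag f (node up j v) = c *: node up j (diag f v).
Proof.
move=> fc; pose g : {linear V -> V} := diag f \o node up j.
pose h : {linear V -> V} := c \*: (node up j \o diag f).
apply: (mon_ext (f := g) (g := h)) => a Aa /=.
rewrite diag_mon linearZ /=; have [d ->] := node_mon_scalar up j a.
by rewrite linearZ /= diag_mon fc !scalerA; congr (_ *: _); ring.
Qed.

Lemma iter_node_mon up j k a :
  exists c, iter k (node up j) (mon a) = c *: mon (a + node_shift up j *+ k).
Proof.
elim: k => [|k [c IHk]]; first by exists 1; rewrite mulr0n addr0 scale1r.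
rewrite iterS IHk linearZ /=.
have [d ->] := node_mon_scalar up j (a + node_shift up j *+ k).
by exists (c * d); rewrite scalerA -addrA -mulrSr.
Qed.

Fact iter_node_is_linear up j k : linear (iter k (node up j)).
Proof. by move=> c u v; elim: k => //= k ->; rewrite linearP. Qed.

HB.instance Definition _ up j k :=
  GRing.isLinear.Build K V V _ (iter k (node up j))
    (iter_node_is_linear up j k).

(** The entry at [lo j] moves by [k], more than its range allows. *)
Lemma node_nilpotent up (j : 'I_(m + n).-1) k v :
  (if (lo j < m)%N then (1 < k)%N else r == Some k) ->
  iter k (node up j) v = 0.
Proof.
move=> kj; pose f : {linear V -> V} := iter k (node up j).
apply: (mon_ext (f := f) (g := \0)) => a Aa /=.
have [c ->] := iter_node_mon up j k a.
rewrite [mon _]mon_out ?scaler0 //; apply/admP => /(_ (lo j)).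
have := adm_at (lo j) Aa.
have -> : (a + node_shift up j *+ k) (lo j) = a (lo j) + (osc_sign up) *+ k.
  by rewrite wtD wtMn /node_shift; case: up {f}; rewrite ?wtN root_lo.
rewrite /in_range; case: ifP kj => [_ k1|_ /eqP ->];
  case: up {f}; rewrite /osc_sign ?mulNrn; lia.
Qed.

Lemma node_comm_distant up i j v :
  distant i j -> node up i (node up j v) = node up j (node up i v).
Proof.
move=> ij; have [ll lh hl hh] :
    [/\ lo i != lo j, lo i != hi j, hi i != lo j & hi i != hi j].
  by move: ij; rewrite /distant -!val_eqE /=; split; lia.
rewrite /node /= (osc_comm _ _ _ hl) (osc_comm _ _ _ ll).
by rewrite (osc_comm _ _ _ hh) (osc_comm _ _ _ lh).
Qed.

(** For adjacent nodes the shared coordinate is lowered, or raised, by both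
operators, and equal moves commute. *)
Lemma node_comm_opposite i j v :
  i != j -> node true i (node false j v) = node false j (node true i v).
Proof.
rewrite -val_eqE /= => ij.
have ll : lo i != lo j by rewrite -val_eqE.
have hh : hi i != hi j by rewrite -val_eqE /= eqSS.
rewrite /node /= (osc_comm_same _ (hi i)) (osc_comm _ _ _ ll).
by rewrite (osc_comm _ _ _ hh) (osc_comm_same _ (lo i)).
Qed.

Lemma linear_serre (f : {linear V -> V}) c u v w :
  f (u - c *: v + w) = f u - c *: f v + f w.
Proof. by rewrite linearD linearB linearZ. Qed.

(** Let [r] be the coordinate shared by [i] and [j], and [p], [s] the other
two.  The oscillators at [p] and [s] are the same in the three words and factor
out, leaving the Serre relation at [r].  When [i] lies in [I_0], the coordinate
of [i] other than [r] is moved twice and every word vanishes. *)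
Lemma node_serre up i j v : adjacent i j -> ~~ odd_node i ->
  node up i (node up i (node up j v))
  - (q + q^-1) *: node up i (node up j (node up i v))
  + node up j (node up i (node up i v)) = 0.
Proof.
rewrite /adjacent /odd_node => /orP[] /eqP ij im; rewrite /node /=.
  have hl : lo j = hi i by apply: val_inj.
  have rp : hi i != lo i by rewrite eq_sym lo_neq_hi.
  have rs : hi i != hi j by rewrite -hl lo_neq_hi.
  have sp : hi j != lo i by rewrite -val_eqE /=; move: ij; lia.
  (* Oscillators at [r] are pushed to the right of all others. *)
  rewrite hl !(osc_comm _ _ _ rp, osc_comm _ _ _ rs, osc_comm _ _ _ sp).
  have [lm|lm] := ltnP (lo i) m.
    by rewrite !(osc_nil _ _ lm) !linear0 !addr0.
  have hm : (m <= hi i)%N by move: lm => /=; lia.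
  have := osc_serre (~~ up) v hm; rewrite negbK => Hs.
  pose F : {linear V -> V} :=
    osc up (lo i) \o (osc up (lo i) \o osc (~~ up) (hi j)).
  by rewrite -[RHS](linear0 F) -Hs linear_serre.
have hl : hi j = lo i by apply: val_inj.
have rp : lo i != lo j by rewrite -hl eq_sym lo_neq_hi.
have rs : lo i != hi i by apply: lo_neq_hi.
have sp : hi i != lo j by rewrite -val_eqE /=; move: ij; lia.
rewrite hl !(osc_comm _ _ _ rp, osc_comm _ _ _ rs, osc_comm _ _ _ sp).
have [lm|lm] := ltnP (lo i) m.
  have hm : (hi i < m)%N by move: im lm => /=; lia.
  by rewrite !(osc_nil _ _ hm) !linear0 !addr0.
have Hs := osc_serre up v lm.
pose F : {linear V -> V} :=
  osc up (lo j) \o (osc (~~ up) (hi i) \o osc (~~ up) (hi i)).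
by rewrite -[RHS](linear0 F) -Hs linear_serre.
Qed.

(** Around the odd node, let [r] be the last coordinate of [I_0] and [s] the
first of [I_1].  At [r] a word consists of two moves in one direction and one in
the other; it vanishes unless they alternate, by [osc_nil].  The surviving words
have the same factor at [r] and form the Serre relation at [s]. *)
Lemma node_quartic up (i j k : 'I_(m + n).-1) v :
  odd_node j -> i.+1 = j :> nat -> k = j.+1 :> nat ->
  node up i (node up j (node up k (node up j v)))
  + node up j (node up i (node up j (node up k v)))
  + node up k (node up j (node up i (node up j v)))
  + node up j (node up k (node up j (node up i v)))
  - (q + q^-1) *: node up j (node up i (node up k (node up j v))) = 0.
Proof.
rewrite /odd_node => /eqP jm ij kj; rewrite /node /=.
have hli : hi i = lo j by apply: val_inj.
have hlj : lo k = hi j by apply: val_inj.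
have rp : lo j != lo i by rewrite -hli eq_sym lo_neq_hi.
have rs : hi j != lo j by rewrite eq_sym lo_neq_hi.
have sz : hi j != hi k by rewrite -hlj lo_neq_hi.
have sp : hi j != lo i by rewrite -val_eqE /=; lia.
have rz : lo j != hi k by rewrite -val_eqE /=; lia.
have zp : hi k != lo i by rewrite -val_eqE /=; lia.
have rm : (lo j < m)%N by rewrite /=; lia.
have sm : (m <= hi j)%N by rewrite /=; lia.
(* Normal order: the two outer coordinates, then [lo j], then [hi j]. *)
rewrite hli hlj !(osc_comm _ _ _ rp, osc_comm _ _ _ sz, osc_comm _ _ _ sp,
  osc_comm _ _ _ rz, osc_comm _ _ _ zp, osc_comm _ _ _ rs).
rewrite !(osc_nil up _ rm) !linear0 add0r addr0 addrAC.
have := osc_serre (~~ up) v sm; rewrite negbK => Hs.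
pose F : {linear V -> V} := osc up (lo i) \o (osc (~~ up) (hi k) \o
  (osc up (lo j) \o (osc (~~ up) (lo j) \o osc up (lo j)))).
by rewrite -[RHS](linear0 F) -Hs linear_serre.
Qed.

(** Both products are diagonal: they are the product of an up-down factor at one
index and a down-up factor at the other. *)
Lemma node_bracket j v :
  node true j (node false j v)
  - (-1) ^+ odd_node j *: node false j (node true j v) =
  (q_ q (lo j) - (q_ q (lo j))^-1)^-1 *:
    (diag (fun a => q ^ form a (root j)) v
     - diag (fun a => q ^ (- form a (root j))) v).
Proof.
have pr : hi j != lo j by rewrite eq_sym lo_neq_hi.
pose f : {linear V -> V} := node true j \o node false j.
pose g1 : {linear V -> V} := node false j \o node true j.
pose h : {linear V -> V} := f \- ((-1) ^+ odd_node j \*: g1).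
pose d1 : {linear V -> V} := diag (fun a => q ^ form a (root j)).
pose d2 : {linear V -> V} := diag (fun a => q ^ (- form a (root j))).
pose k : {linear V -> V} :=
  (q_ q (lo j) - (q_ q (lo j))^-1)^-1 \*: (d1 \- d2).
apply: (mon_ext (f := h) (g := k)) => a _ {f g1 h d1 d2 k} /=.
rewrite !diag_mon /node /= !(osc_comm _ _ _ pr) osc_dn_up osc_up_dn.
rewrite !oscZ osc_dn_up osc_up_dn !scalerA -!scalerBl !scalerA.
congr (_ *: _); rewrite form_root !form_eps /odd_node /q_.
have [lm|lm] := ltnP (lo j) m; have [hm|hm] := ltnP (hi j) m.
- have -> : (j.+1 == m) = false by move: hm => /=; lia.
  rewrite expr0 mul1r (mulrC [_]q) [X in _ - X]mulrC qnum_bracket00 //.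
  by rewrite /qnum mulrC.
- have -> : (j.+1 == m) by move: lm hm => /=; lia.
  rewrite expr1 !mulN1r ?mulNr !opprK (mulrC [_]q) [X in _ + X]mulrC.
  rewrite qnum_bracket01 //.
  by rewrite /qnum mulrC.
- by move: lm hm => /=; lia.
have -> : (j.+1 == m) = false by move: lm => /=; lia.
rewrite expr0 mul1r (mulrC [_]q) [X in _ - X]mulrC qnum_bracket11 // invrK.
have -> : - a (lo j) - - a (hi j) = - (a (lo j) - a (hi j)) by ring.
by rewrite opprK /qnum -(opprB q) invrN mulNr -mulrN !opprB mulrC.
Qed.

(** * Comparison with the twisted operators *)

(** The factor by which [x_i] and [d_i] differ from oscillators. *)
Definition twist (i : 'I_(m + n)) (a : wt) : K :=
  (- q) ^ star (eps i) (part0 a) * q ^ star (eps i) (part1 a).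

Lemma Nq_neq0 : - q != 0. Proof. by rewrite oppr_eq0. Qed.

Lemma twist_neq0 i a : twist i a != 0.
Proof. by rewrite mulf_neq0 // expfz_neq0 // Nq_neq0. Qed.

(** The two twists in [E_j] or [F_j] belong to neighbouring indices, so their
quotient depends on the entry at [lo j] alone. *)
Lemma twist_hi j a : twist (hi j) a =
  twist (lo j) a * (if (lo j < m)%N then - q else q) ^ a (lo j).
Proof.
rewrite /twist !star_hi !expfzDr ?Nq_neq0 // [part0 _ _]ffunE [part1 _ _]ffunE.
case: ifP => _; rewrite expr0z mulr1 ?mulrA //.
by rewrite mulrAC.
Qed.

Lemma twist_shift up (i k : 'I_(m + n)) a :
  (i <= k)%N -> twist i (a + osc_shift up k) = twist i a.
Proof.
move=> ik; rewrite /twist !starE; congr (_ ^ _ * _ ^ _);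
  apply: eq_bigr => k' k'i; rewrite [LHS]ffunE [RHS]ffunE osc_shift_ne //;
  by rewrite -val_eqE neq_ltn (leq_trans k'i ik).
Qed.

(** The formulas of [x_op] and, below, of [d_op], over the abstract space. *)
Definition x_fun (i : 'I_(m + n)) (a : wt) : V :=
  if (i < m)%N then
    if a i == 0 then (- q) ^ (- star (eps i) (part0 a)) *: mon (a + eps i)
    else 0
  else ((- q) ^ (- star (eps i) (part0 a)) * q ^ (- star (eps i) (part1 a))
        * qnum q (a i + 1)) *: mon (a + eps i).

Definition d_fun (i : 'I_(m + n)) (a : wt) : V :=
  if (i < m)%N then
    if a i == 1 then (- q) ^ star (eps i) (part0 a) *: mon (a - eps i)
    else 0
  else ((- q) ^ star (eps i) (part0 a) * q ^ star (eps i) (part1 a))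
       *: mon (a - eps i).

Lemma x_untwist i v :
  lext (x_fun i) v = osc true i (diag (fun a => (twist i a)^-1) v).
Proof.
pose h : {linear V -> V} := osc true i \o diag (fun a => (twist i a)^-1).
apply: (mon_ext (f := lext (x_fun i)) (g := h)) => a Aa /=.
rewrite lext_mon // diag_mon linearZ /= osc_mon // scalerA /x_fun /twist invfM.
rewrite !invr_expz; case: ifP => [im|_] //.
rewrite star_part1_le 1?ltnW // oppr0 expr0z mulr1.
have := adm_at i Aa; rewrite /in_range im => ai.
have [a0|a0] := eqVneq (a i) 0.
  by rewrite /osc_coef a0 add0r qnum1 // mulr1.
rewrite [mon _]mon_out ?scaler0 //; apply/negP => /(adm_at i).
by rewrite /in_range im wtD epsii; move: ai a0; lia.
Qed.

Lemma d_untwist i v : lext (d_fun i) v = osc false i (diag (twist i) v).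
Proof.
pose h : {linear V -> V} := osc false i \o diag (twist i).
apply: (mon_ext (f := lext (d_fun i)) (g := h)) => a Aa /=.
rewrite lext_mon // diag_mon linearZ /= osc_mon // scale1r /d_fun /twist.
case: ifP => [im|_] //.
rewrite star_part1_le 1?ltnW // expr0z mulr1.
have := adm_at i Aa; rewrite /in_range im => ai.
have [//|a1] := eqVneq (a i) 1.
rewrite [mon _]mon_out ?scaler0 //; apply/negP => /(adm_at i).
by rewrite /in_range im wtB epsii; move: ai a1; lia.
Qed.

Definition sigma_eig (i : 'I_(m + n)) (a : wt) : K :=
  q ^ (if (i < m)%N then a i else - a i).

Definition sigmaV_eig (i : 'I_(m + n)) (a : wt) : K :=
  q ^ (- (if (i < m)%N then a i else - a i)).

(** The quotient of the twists is cancelled by [sigma] when [lo j] is in [I_1].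
When it is in [I_0] the two agree up to a factor that is [1] for [a_lo = 0], and
for [a_lo = 1] both sides vanish. *)
Lemma node_natural_E j v :
  node true j v =
  lext (x_fun (lo j)) (lext (d_fun (hi j)) (diag (sigma_eig (lo j)) v)).
Proof.
rewrite x_untwist d_untwist.
pose h : {linear V -> V} := osc true (lo j) \o
  (diag (fun a => (twist (lo j) a)^-1) \o
   (osc false (hi j) \o (diag (twist (hi j)) \o diag (sigma_eig (lo j))))).
apply: (mon_ext (f := node true j) (g := h)) => a Aa /=.
rewrite !(diag_mon, diagZ, oscZ) (osc_mon false) // scale1r diag_mon oscZ.
rewrite twist_shift // !scalerA.
have -> : osc true (lo j) (mon (a + osc_shift false (hi j))) =
          node true j (mon a) by rewrite /node /= (osc_mon false) // scale1r.
have T0 := twist_neq0 (lo j) a; rewrite twist_hi /sigma_eig.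
case: ifP => jm.
  have [a0|a0] := eqVneq (a (lo j)) 0.
    rewrite a0 [X in X *: _](_ : _ = 1) ?scale1r // !expr0z.
    by field.
  rewrite (_ : node _ _ _ = 0) ?scaler0 //.
  rewrite node_mon // [mon _]mon_out ?scaler0 //; apply/negP.
  move/(adm_at (lo j)); have := adm_at (lo j) Aa.
  rewrite /in_range jm /node_shift /root wtD wtB epsii epsE.
  by rewrite (negbTE (lo_neq_hi j)); move: a0; lia.
rewrite [X in X *: _](_ : _ = 1) ?scale1r // -invr_expz.
by field; rewrite T0 expfz_neq0.
Qed.

(** As for [E_j], but the twists are compared after the lowering, at the
exponent [a']. *)
Lemma node_natural_F j v :
  node false j v =
  diag (sigmaV_eig (lo j)) (lext (x_fun (hi j)) (lext (d_fun (lo j)) v)).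
Proof.
rewrite x_untwist d_untwist.
pose h : {linear V -> V} := diag (sigmaV_eig (lo j)) \o (osc true (hi j) \o
  (diag (fun a => (twist (hi j) a)^-1) \o
   (osc false (lo j) \o diag (twist (lo j))))).
apply: (mon_ext (f := node false j) (g := h)) => a Aa /=.
rewrite !(diag_mon, diagZ, oscZ) (osc_mon false) // scale1r diag_mon.
rewrite !oscZ !diagZ.
have [c Ec] := osc_mon_scalar true (hi j) (a + osc_shift false (lo j)).
have -> : node false j (mon a) =
    osc true (hi j) (mon (a + osc_shift false (lo j))).
  by rewrite /node /= (osc_comm _ _ _ (lo_neq_hi j)) (osc_mon false) // scale1r.
rewrite Ec diagZ diag_mon twist_hi twist_shift //.
set a' := a + osc_shift false (lo j).
have -> : sigmaV_eig (lo j) (a' + osc_shift true (hi j)) = sigmaV_eig (lo j) a'.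
  by rewrite /sigmaV_eig osc_shift_ne ?lo_neq_hi.
have T0 := twist_neq0 (lo j) a; rewrite /sigmaV_eig.
rewrite [c *: (_ *: _)]scalerA [c * _]mulrC -[(_ * c) *: _]scalerA -Ec !scalerA.
case: ifP => jm.
  have [a0|a0] := eqVneq (a' (lo j)) 0.
    rewrite a0 [X in X *: _](_ : _ = 1) ?scale1r // !expr0z.
    by field.
  rewrite (mon_out (a := a')) ?linear0 //; apply/negP.
  move/(adm_at (lo j)); have := adm_at (lo j) Aa.
  by move: a0; rewrite /in_range jm /a' osc_shift_at /osc_sign; lia.
rewrite opprK [X in X *: _](_ : _ = 1) ?scale1r //.
by field; rewrite T0 expfz_neq0.
Qed.

Lemma torus_eps (i : 'I_(m + n)) v :
  diag (fun a => q ^ form a (eps i)) v = diag (sigma_eig i) v.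
Proof. by apply: eq_diag => a; rewrite form_eps. Qed.

Lemma torus_root j v :
  diag (fun a => q ^ form a (root j)) v =
  diag (sigma_eig (lo j)) (diag (sigmaV_eig (hi j)) v).
Proof.
rewrite diag_comp; apply: eq_diag => a.
by rewrite form_root !form_eps expfzDr.
Qed.

(** * The defining relations *)

Variable g : lie_type.

(** Pairing with [torus_wt] treats the toral generators of [gl] and [sl]
together. *)
Definition torus_eig (a : wt) (t : 'I_(torus_size m n g)) : K :=
  q ^ form a (torus_wt t).

Lemma comm_coefE (i : 'I_(m + n)) (j : 'I_(m + n).-1) :
  comm_coef q i j = q ^ form (root j) (eps i).
Proof.
rewrite /comm_coef form_eps /q_ /root wtB !epsE.
have -> : ((if i == lo j then 1 else 0) - (if i == hi j then 1 else 0) : int)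
  = (i == lo j)%:R - (i == hi j)%:R by do 2!case: eqP.
by case: ifP => // _; rewrite exprz_inv.
Qed.

Lemma torus_coefE t j : torus_coef q t j = torus_eig (root j) t.
Proof.
rewrite /torus_eig /torus_coef; case: g t => t /=; rewrite comm_coefE //.
by rewrite comm_coefE form_sym [in RHS]form_sym [in RHS]formDl formNl expfzDr //
  invr_expz (form_sym (eps (hi t))) // form_sym.
Qed.

Lemma torus_eigD a b t : torus_eig (a + b) t = torus_eig a t * torus_eig b t.
Proof. by rewrite /torus_eig formDl expfzDr. Qed.

Lemma torus_eigN a t : torus_eig (- a) t = (torus_eig a t)^-1.
Proof. by rewrite /torus_eig formNl invr_expz. Qed.

Lemma torus_eig_neq0 a t : torus_eig a t != 0.
Proof. exact: expfz_neq0. Qed.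

(** [[l] = 0] says that [q ^ (2 l) = 1]. *)
Lemma torus_eig_order l a t : r = Some l -> torus_eig a t ^+ (2 * l) = 1.
Proof.
move=> rl; have /eqP := qnum_r rl; rewrite /qnum mulf_eq0 invr_eq0.
rewrite (negbTE (qB_neq0 q_neq0 q2_neq1)) orbF subr_eq0 => /eqP ql.
have q2l : q ^+ (2 * l) = 1.
  rewrite mul2n -addnn exprD exprnP {1}ql -invr_expz mulVf //.
  exact: expfz_neq0.
by rewrite /torus_eig exprnP exprzAC -exprnP q2l exp1rz.
Qed.

Lemma torus_eig_shift up j t a :
  torus_eig (a + node_shift up j) t =
  (if up then torus_coef q t j else (torus_coef q t j)^-1) * torus_eig a t.
Proof.
rewrite torus_eigD mulrC torus_coefE /node_shift.
by case: up; rewrite ?torus_eigN.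
Qed.

Definition parity (a : wt) : K := (-1) ^ degree (part1 a).

Lemma parityD a b : parity (a + b) = parity a * parity b.
Proof. by rewrite /parity part1D degreeD expfzDr // oppr_eq0 oner_eq0. Qed.

Lemma parity_node_shift up j : parity (node_shift up j) = (-1) ^+ odd_node j.
Proof.
have E : degree (part1 (root j)) = - (odd_node j)%:R :> int.
  rewrite /root part1D part1N !part1_eps /= /odd_node.
  have [jm|jm] := ltnP j m; have [jm1|jm1] := ltnP j.+1 m.
  - rewrite subr0 /degree big1 => [|i _]; last by rewrite ffunE.
    by have -> : (j.+1 == m) = false by lia.
  - rewrite sub0r degreeN (degree_eps (hi j)).
    by have -> : (j.+1 == m) = true by lia.
  - by lia.
  rewrite degreeD degreeN (degree_eps (lo j)) (degree_eps (hi j)).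
  by have -> : (j.+1 == m) = false by lia.
have E' : degree (part1 (node_shift up j)) =
    (-1) ^+ up * (odd_node j)%:R :> int.
  by rewrite /node_shift; case: up; rewrite ?part1N ?degreeN E; ring.
rewrite /parity E'; case: up {E'}; case: (odd_node j);
  by rewrite ?mulr0 ?expr0z // mulr1 ?expr1 ?expr0 ?exprN1 ?invrN1 ?expr1z.
Qed.

Lemma parity_sq a : parity a * parity a = 1.
Proof. by rewrite /parity -expfzMl mulrNN mulr1 exp1rz. Qed.

(** Only the odd node changes the degree in [I_1], and it does so by one. *)
Lemma parity_conj up j v :
  diag parity (node up j (diag parity v)) = (-1) ^+ odd_node j *: node up j v.
Proof.
rewrite (diag_node (c := (-1) ^+ odd_node j)).
  by rewrite diag_comp diag1 //; apply: parity_sq.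
by move=> a; rewrite parityD parity_node_shift mulrC.
Qed.

Definition op (x : generator m n g) : {linear V -> V} :=
  match x with
  | genE j => node true j
  | genF j => node false j
  | genK t => diag (fun a => torus_eig a t)
  | genKV t => diag (fun a => (torus_eig a t)^-1)
  | gensigma => diag parity
  end.

Local Notation act := (free_act op).

Lemma act_gen x v : act (gen K x) v = op x v.
Proof. exact: free_act_gen. Qed.

(** The lemmas below compute the operator of an element along its syntax, which
turns each relation into an identity between operators. *)
Definition acts (x : {malg K[{fmonom (generator m n g)}]}) (f : V -> V) :=
  forall v, act x v = f v.

Lemma actsM x y f f' :
  acts x f -> acts y f' -> acts (x * y) (fun v => f (f' v)).
Proof. by move=> xf yf v; rewrite free_actM yf xf. Qed.

Lemma acts_sign (b : bool) x f :
  acts x f -> acts ((-1) ^+ b * x) (fun v => (-1) ^+ b *: f v).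
Proof.
move=> xf v; case: b; last by rewrite expr0 mul1r scale1r xf.
by rewrite expr1 mulN1r free_actN xf scaleN1r.
Qed.

Lemma actsX x f k : acts x f -> acts (x ^+ k) (iter k f).
Proof. by move=> xf v; rewrite free_actX; apply: eq_iter. Qed.

Lemma actsD x y f f' :
  acts x f -> acts y f' -> acts (x + y) (fun v => f v + f' v).
Proof. by move=> xf yf v; rewrite free_actD xf yf. Qed.

Lemma actsN x f : acts x f -> acts (- x) (fun v => - f v).
Proof. by move=> xf v; rewrite free_actN xf. Qed.

Lemma actsZ c x f : acts x f -> acts (c *: x) (fun v => c *: f v).
Proof. by move=> xf v; rewrite free_actZ xf. Qed.

Lemma acts0 : acts 0 (fun=> 0).
Proof. exact: free_act0. Qed.

Lemma acts1 : acts 1 id.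
Proof. exact: free_act1. Qed.

Lemma acts_rel x y f f' :
  acts x f -> acts y f' -> f =1 f' -> forall v, act x v = act y v.
Proof. by move=> xf yf ff v; rewrite xf yf. Qed.

Lemma act_calK j v :
  act (calK K g j) v = diag (fun a => q ^ form a (root j)) v.
Proof.
rewrite /calK /op /torus_eig; case: g => /=; last by rewrite free_act_gen.
rewrite free_actM !free_act_gen /= diag_comp; apply: eq_diag => a.
by rewrite form_root expfzDr // invr_expz.
Qed.

Lemma act_calKV j v :
  act (calKV K g j) v = diag (fun a => q ^ (- form a (root j))) v.
Proof.
rewrite /calKV /op /torus_eig; case: g => /=; last first.
  by rewrite free_act_gen; apply: eq_diag => a /=; rewrite invr_expz.
rewrite free_actM !free_act_gen /= diag_comp; apply: eq_diag => a.
by rewrite form_root opprB addrC expfzDr // invr_expz.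
Qed.

Ltac acts_step := lazymatch goal with
  | |- acts (gen _ _) _ => exact: act_gen
  | |- acts (calK _ _ _) _ => exact: act_calK
  | |- acts (calKV _ _ _) _ => exact: act_calKV
  | |- acts ((-1) ^+ _ * _) _ => apply: acts_sign
  | |- acts (_ * _) _ => apply: actsM
  | |- acts (_ ^+ _) _ => apply: actsX
  | |- acts (_ + _) _ => apply: actsD
  | |- acts (- _) _ => apply: actsN
  | |- acts (_ *: _) _ => apply: actsZ
  | |- acts 0 _ => exact: acts0
  | |- acts 1 _ => exact: acts1
  end.

Ltac acts_solve := eapply acts_rel; [do ![acts_step] | do ![acts_step] |].

Theorem op_relations x y : Uq_rel q r x y -> forall v, act x v = act y v.
Proof.
case=> {x y}.
- move=> s t; acts_solve => v /=; rewrite !diag_comp.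
  by apply: eq_diag => a; rewrite mulrC.
- move=> t; acts_solve => v /=; rewrite diag_comp diag1 // => a.
  by rewrite mulfV // torus_eig_neq0.
- move=> t; acts_solve => v /=; rewrite diag_comp diag1 // => a.
  by rewrite mulVf // torus_eig_neq0.
- move=> t j; acts_solve => v /=; apply: diag_node => a.
  exact: (torus_eig_shift true).
- move=> t j; acts_solve => v /=; apply: diag_node => a.
  exact: (torus_eig_shift false).
- move=> i j; case: eqVneq => [<-|ij]; acts_solve => v /=.
    by rewrite andbb node_bracket scalerBr.
  rewrite node_comm_opposite //.
  have -> : (odd_node i && odd_node j) = false.
    apply: contraNF ij => /andP[/eqP im /eqP jm].
    by apply/eqP/val_inj; apply: succn_inj; rewrite im jm.
  by rewrite expr0 scale1r subrr.
- by move=> i j ij; acts_solve => v; apply: node_comm_distant.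
- by move=> i j ij; acts_solve => v; apply: node_comm_distant.
- by move=> i j ij im; acts_solve => v; apply: node_serre.
- by move=> i j ij im; acts_solve => v; apply: node_serre.
- move=> j /eqP jm; acts_solve => v; apply: (@node_nilpotent true j 2).
  by have -> : (lo j < m)%N by rewrite /=; lia.
- move=> j /eqP jm; acts_solve => v; apply: (@node_nilpotent false j 2).
  by have -> : (lo j < m)%N by rewrite /=; lia.
- by move=> i j k jm ij kj; acts_solve => v; apply: node_quartic.
- by move=> i j k jm ij kj; acts_solve => v; apply: node_quartic.
- by acts_solve => v /=; rewrite diag_comp diag1 //; apply: parity_sq.
- by move=> j; acts_solve => v; apply: parity_conj.
- by move=> j; acts_solve => v; apply: parity_conj.
- move=> t; acts_solve => v /=; rewrite !diag_comp; apply: eq_diag => a.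
  by rewrite mulrAC parity_sq mul1r.
- move=> l j rl jm; acts_solve => v.
  apply: (@node_nilpotent true j l); rewrite rl.
  by case: ifP => // _; apply: r_gt1.
- move=> l j rl jm; acts_solve => v.
  apply: (@node_nilpotent false j l); rewrite rl.
  by case: ifP => // _; apply: r_gt1.
move=> l t rl; acts_solve => v /=.
rewrite iter_diag diag1 // => a.
exact: torus_eig_order.
Qed.

(** * Simplicity and highest weight *)

Definition rep : Uq q m n g r -> V -> V :=
  presented_act op (R := Uq_rel q r).

Lemma rep_action : is_action rep.
Proof. exact: (presented_act_is_action op_relations). Qed.

Lemma rep_gen x v : rep (Ugen q r x) v = op x v.
Proof.
by rewrite /rep /Ugen (presented_act_pi op_relations); apply: act_gen.
Qed.

Lemma repM u u' v : rep (u * u') v = rep u (rep u' v).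
Proof. by case: rep_action. Qed.

Lemma rep_scale u c v : rep u (c *: v) = c *: rep u v.
Proof. exact: linearZ. Qed.

Lemma repD u v w : rep u (v + w) = rep u v + rep u w.
Proof. exact: linearD. Qed.

Lemma rep0 u : rep u 0 = 0.
Proof. exact: linear0. Qed.

Lemma rep1 v : rep 1 v = v.
Proof. by case: rep_action. Qed.

Lemma rep_Dl u u' v : rep (u + u') v = rep u v + rep u' v.
Proof. by case: rep_action => /(_ v 1 u u'); rewrite !scale1r. Qed.

Lemma rep_0l v : rep 0 v = 0.
Proof.
have [/(_ v) lin _ _ _] := rep_action.
by have := lin (-1) 0 0; rewrite scaler0 addr0 scaleN1r addNr.
Qed.

Lemma rep_Zl c u v : rep (c *: u) v = c *: rep u v.
Proof.
have [/(_ v) lin _ _ _] := rep_action.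
by have := lin c u 0; rewrite !addr0 rep_0l addr0.
Qed.

(** [H] plays the role of the homogeneous component of degree [t]. *)
Variable H : V -> Prop.
Variable t : int.
Hypothesis H0 : H 0.
Hypothesis HD : forall v w, H v -> H w -> H (v + w).
Hypothesis HZ : forall c v, H v -> H (c *: v).
Hypothesis H_mon : forall a, adm a -> degree a = t -> H (mon a).
Hypothesis H_dec : forall v, H v -> exists (s : seq wt) (c : wt -> K),
  [/\ uniq s, forall a, a \in s -> [/\ adm a, degree a = t & c a != 0]
    & v = \sum_(a <- s) c a *: mon a].

Lemma op_mon x a :
  exists c b, op x (mon a) = c *: mon b /\ degree b = degree a.
Proof.
case: x => [j|j|t'|t'|] /=; try by eexists; exists a; rewrite diag_mon; split.
  have [c Ec] := node_mon_scalar true j a.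
  by exists c, (a + node_shift true j); rewrite degreeD degree_node_shift addr0.
have [c Ec] := node_mon_scalar false j a.
by exists c, (a + node_shift false j); rewrite degreeD degree_node_shift addr0.
Qed.

Lemma spanned_is_submodule : is_submodule rep H.
Proof.
apply: presented_act_invariant => // x v /H_dec[s [c [_ sP ->]]].
rewrite linear_sum big_seq; elim/big_rec: _ => // a w /sP[_ da _] Hw.
apply: HD => //; rewrite linearZ; apply: HZ.
have [d [b [-> db]]] := op_mon x a.
have [Ab|Nb] := boolP (adm b); last by rewrite mon_out ?scaler0.
by apply: HZ; apply: H_mon; rewrite // db.
Qed.

Hypothesis qnum_neq0 :
  forall (i : 'I_(m + n)) x, in_range r i x -> 0 < x -> [x]q != 0.
Hypothesis mon_neq0 : forall a, adm a -> mon a != 0.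

(** [mon a] and [mon l] generate each other.  The first field is used to send a
combination of monomials to [mon l], so it also records that [u] translates
every monomial by the same exponent; the last two make [l] the unique exponent
of least height. *)
Record linked (l a : wt) : Prop := Linked {
  linked_up : exists u,
    (forall b, exists c, rep u (mon b) = c *: mon (b + (l - a))) /\
    exists2 c, c != 0 & rep u (mon a) = c *: mon l;
  linked_down : exists u, exists2 c, c != 0 & rep u (mon l) = c *: mon a;
  linked_height : height l <= height a;
  linked_eq : height l = height a -> a = l }.

(** Induction on the height, which is nonnegative: unless [a = l], some root can
be added to [a], and the coefficients of [E_j] and [F_j] along that step are
quantum integers of positive entries in range. *)
Lemma linked_extremal l a :
  extremal r l -> adm a -> degree a = degree l -> linked l a.
Proof.
move=> Tl; have [N] := ubnP (absz (height a)); elim: N a => // N IHN a hN Aa da.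
have [[j Ar]|top] := pselect (exists j, adm (a + root j)); last first.
  have -> : a = l.
    apply: (extremal_unique r_gt1) => //; split=> // j.
    by apply/negP => Ar; apply: top; exists j.
  split=> //.
    exists 1; split=> [b|]; last by exists 1; rewrite ?oner_neq0 ?rep1 ?scale1r.
    by exists 1; rewrite rep1 subrr addr0 scale1r.
  by exists 1, 1; rewrite ?oner_neq0 ?rep1 ?scale1r.
have hr : height (a + root j) = height a - 1 by rewrite heightD height_root.
have h0 := height_ge0 Ar.
have dr : degree (a + root j) = degree l.
  by rewrite degreeD (degree_node_shift true) addr0.
have [|[u [uP [c c0 uc]]] [u' [c' c'0 uc']] hl _] := IHN _ _ Ar dr.
  by move: hN h0; rewrite hr; lia.
have := Ar; rewrite adm_root // => /andP[rl rh].
have lo0 : [a (lo j) + 1]q != 0.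
  apply: (qnum_neq0 rl); have /andP[] := adm_at (lo j) Aa; lia.
have hi0 : [a (hi j)]q != 0 by apply: (qnum_neq0 (adm_at (hi j) Aa)).
split.
- exists (u * Ugen q r (genE g j)); split=> [b|].
    have [d Ed] := node_mon_scalar true j b; have [d' Ed'] := uP (b + root j).
    exists (d * d'); rewrite repM rep_gen /= Ed rep_scale Ed' scalerA.
    congr (_ *: mon _).
    by rewrite opprD (addrA l) -(addrA b) (addrC (root j)) subrK.
  exists ([a (lo j) + 1]q * c); first by rewrite mulf_neq0.
  by rewrite repM rep_gen /= node_mon // rep_scale uc scalerA.
- exists (Ugen q r (genF g j) * u'); exists (c' * [a (hi j)]q).
    by rewrite mulf_neq0.
  rewrite repM uc' rep_scale rep_gen /= node_mon // scalerA.
  by rewrite wtD root_hi subrK /node_shift addrK.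
- by apply: le_trans hl _; rewrite hr gerBl.
by move: hl; rewrite hr => + E; rewrite E lerDl oppr_ge0 ler10.
Qed.

Lemma seq_argmax (T : eqType) (s : seq T) (f : T -> int) :
  s != [::] -> exists2 x, x \in s & {in s, forall y, f y <= f x}.
Proof.
case: s => // x s _; elim: s x => [|y s IHs] x.
  by exists x; rewrite ?mem_head // => y; rewrite inE => /eqP->.
have [z zs zmax] := IHs y; have [zx|xz] := leP (f z) (f x).
  exists x; rewrite ?mem_head // => w; rewrite inE => /predU1P[->//|ws].
  exact: le_trans (zmax _ ws) zx.
exists z; first by rewrite inE zs orbT.
by move=> w; rewrite inE => /predU1P[->|]; [apply: ltW | apply: zmax].
Qed.

Lemma submodule_sum N' (s : seq wt) (F : wt -> V) :
  is_submodule rep N' -> (forall a, a \in s -> N' (F a)) ->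
  N' (\sum_(a <- s) F a).
Proof.
case=> N0 ND _ _ NF; rewrite big_seq.
by elim/big_rec: _ => // a w /NF Na Nw; apply: ND.
Qed.

Lemma rep_sum u (s : seq wt) (F : wt -> V) :
  rep u (\sum_(a <- s) F a) = \sum_(a <- s) rep u (F a).
Proof. by rewrite (big_morph (rep u) (repD u) (rep0 u)). Qed.

(** A monomial of greatest height in the support is the only one that survives
when it is raised to [mon l]. *)
Lemma simple_extremal (l : wt) :
  extremal r l -> degree l = t -> is_simple rep H.
Proof.
move=> Tl dl; have [Al _] := Tl; split; first exact: spanned_is_submodule.
  by exists (mon l); [apply: H_mon | apply: mon_neq0].
move=> N' N'sub N'H; have [N'0|[v N'v v0]] :
    (forall v, N' v -> v = 0) \/ (exists2 v, N' v & v != 0).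
- have [ex|nex] := pselect (exists2 v, N' v & v != 0); [by right|left].
  by move=> v N'v; have [//|v0] := eqVneq v 0; case: nex; exists v.
- by left.
right; have [_ ND NZ Nrep] := N'sub.
have [s [c [us sP Ev]]] := H_dec (N'H _ N'v).
have s0 : s != [::].
  by apply: contraNneq v0 => s0; rewrite Ev s0 big_nil.
have [b bs bmax] := seq_argmax (@height m n) s0; have [Ab db cb] := sP b bs.
have [[u [uP [d d0 ub]]] _ _ _] :=
  linked_extremal Tl Ab (etrans db (esym dl)).
have N'l : N' (mon l).
  have Eu : rep u v = (c b * d) *: mon l.
    rewrite Ev rep_sum (bigD1_seq b) //= big_seq_cond big1 ?addr0.
      by rewrite rep_scale ub scalerA.
    move=> b' /andP[b's b'b]; rewrite rep_scale.
    have [d' ->] := uP b'; rewrite mon_out ?scaler0 //; apply/negP => Ab'.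
    have [_ db' _] := sP b' b's.
    have := linked_extremal Tl Ab'.
    rewrite !degreeD degreeN db' db dl subrr addr0.
    case=> // _ _ hl eql; case/eqP: b'b; have hb := bmax b' b's.
    move: hl eql; rewrite !heightD heightN => hl eql.
    (* As [b] has the greatest height, [b' + (l - b)] is no higher than [l]. *)
    have squeeze (x y z : int) : x <= y + (x - z) -> y <= z -> x = y + (x - z).
      by clear; lia.
    have : b' + (l - b) = l by apply: eql; apply: squeeze.
    by rewrite addrCA => /(canRL (addKr _)); rewrite addNr => /eqP;
      rewrite subr_eq0 => /eqP.
  have := NZ (c b * d)^-1 _ (Nrep u _ N'v).
  by rewrite Eu scalerA mulVf ?mulf_neq0 // scale1r.
move=> w Hw; have [s' [c' [_ s'P ->]]] := H_dec Hw.
apply: submodule_sum => // a /s'P[Aa da _]; apply: (NZ).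
have [_ [u' [d' d'0 ua]] _ _] := linked_extremal Tl Aa (etrans da (esym dl)).
by have := NZ d'^-1 _ (Nrep u' _ N'l); rewrite ua scalerA mulVf // scale1r.
Qed.

Lemma generated_extremal (l : wt) : extremal r l -> degree l = t ->
  generated_by rep (mon l) H.
Proof.
move=> Tl dl w; have [Al _] := Tl; split=> [Hw|[u ->]]; last first.
  by case: spanned_is_submodule => _ _ _; apply; apply: H_mon.
have [s [c [_ sP ->]]] := H_dec Hw; rewrite big_seq.
elim/big_rec: _ => [|a v /sP[Aa da _] [u ->]].
  by exists 0; rewrite rep_0l.
have [_ [u' [d' d'0 ua]] _ _] := linked_extremal Tl Aa (etrans da (esym dl)).
by exists ((c a / d') *: u' + u); rewrite rep_Dl rep_Zl ua scalerA divfK.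
Qed.

Lemma highest_extremal (l : wt) : extremal r l ->
  is_highest_weight_vector rep l (mon l).
Proof.
case=> Al top; split=> [|j|t']; first exact: mon_neq0.
  by rewrite rep_gen /= node_mon // mon_out ?scaler0 //; apply: top.
by rewrite rep_gen /= diag_mon.
Qed.

Theorem simple_hw_extremal (l : wt) : extremal r l -> degree l = t ->
  is_simple_hw rep H l (mon l).
Proof.
move=> Tl dl; split; [exact: simple_extremal Tl dl | exact: highest_extremal |].
exact: generated_extremal.
Qed.

End FockModel.

(** * The quantum dual Grassmann superalgebra *)

Section Omega.
Variables (K : fieldType) (q : K) (m n : nat) (r : option nat).

Local Notation wt := {ffun 'I_(m + n) -> int}.
Local Notation Om := (Omega K m n r).
Local Notation bas := (basis m n r).
Local Notation adm := (@admissible m n r).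
Local Notation monO := (@mon K m n r).

Lemma mon_val (b : bas) : monO (val b) = (<< b >> : {malg K[bas]}).
Proof. by rewrite /mon valK. Qed.

Lemma Omega_mon_out (a : wt) : ~~ adm a -> monO a = 0.
Proof. by move=> na; rewrite /mon insubN. Qed.

Lemma Omega_mon_neq0 (a : wt) : adm a -> monO a != 0.
Proof.
move=> Aa; rewrite -[a]/(val (Sub a Aa : bas)) mon_val.
by rewrite (@monalgU_eq0 bas K) oner_neq0.
Qed.

Lemma lin_extE (f : wt -> Om) (v : Om) :
  lin_ext f v = malg_lift (fun b : bas => f (val b)) v.
Proof. by []. Qed.

Fact lin_ext_is_linear (f : wt -> Om) : linear (lin_ext f).
Proof. move=> c u v; rewrite !lin_extE; exact: linearP. Qed.
HB.instance Definition _ (f : wt -> Om) :=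
  GRing.isLinear.Build K Om Om _ (lin_ext f) (lin_ext_is_linear f).

Definition lin_ext_linear (f : wt -> Om) : {linear Om -> Om} := lin_ext f.

Lemma lin_ext_mon (f : wt -> Om) (a : wt) :
  adm a -> lin_ext_linear f (monO a) = f a.
Proof.
move=> Aa; rewrite -[a]/(val (Sub a Aa : bas)) mon_val.
by rewrite /lin_ext_linear /= lin_extE malg_liftU.
Qed.

Lemma Omega_ext (f g : {linear Om -> Om}) :
  (forall a, adm a -> f (monO a) = g (monO a)) -> f =1 g.
Proof.
move=> fg; apply: (@malg_lift_eq K bas Om f g) => b.
by rewrite -mon_val; apply: fg; apply: valP.
Qed.

Lemma homog0 t : homog t (0 : Om).
Proof. by move=> b; rewrite msupp0 in_fset0. Qed.

Lemma homogD t (v w : Om) : homog t v -> homog t w -> homog t (v + w).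
Proof.
move=> hv hw b /(fsubsetP (msuppD_le _ _)); rewrite in_fsetU.
by case/orP=> [/hv|/hw].
Qed.

Lemma homogZ t c (v : Om) : homog t v -> homog t (c *: v).
Proof. by move=> hv b /(fsubsetP (msuppZ_le _ _)) /hv. Qed.

Lemma homog_mon t (a : wt) : adm a -> degree a = t%:Z -> homog t (monO a).
Proof.
move=> Aa da b; rewrite -[a]/(val (Sub a Aa : bas)) mon_val.
by move/(fsubsetP msuppU_le); rewrite in_fset1 => /eqP->.
Qed.

(** The decomposition is indexed by exponents rather than by the subtype
[basis], which lets them be translated freely. *)
Lemma homog_dec t (v : Om) : homog t v ->
  exists (s : seq wt) (c : wt -> K),
  [/\ uniq s, forall a, a \in s -> [/\ adm a, degree a = t%:Z & c a != 0]
    & v = \sum_(a <- s) c a *: monO a].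
Proof.
move=> hv; pose c (a : wt) := if insub a is Some b then
  mcoeff (b : bas) (v : {malg K[bas]}) else 0.
have cE (b : bas) : c (val b) = mcoeff b (v : {malg K[bas]}).
  by rewrite /c valK.
exists [seq val b | b <- msupp (v : {malg K[bas]})], c; split.
- by rewrite map_inj_uniq ?fset_uniq //; apply: val_inj.
- move=> _ /mapP[b bv ->]; split; [exact: valP | exact: hv |].
  by rewrite cE mcoeff_neq0.
rewrite big_map [LHS](@malg_sumE K bas); apply: eq_bigr => b _.
by rewrite cE mon_val.
Qed.

Hypotheses (q_neq0 : q != 0) (q2_neq1 : q ^+ 2 != 1).
Hypothesis r_gt1 : forall l, r = Some l -> (1 < l)%N.
Hypothesis qnum_r : forall l, r = Some l -> qnum q l%:Z = 0.
Variable g : lie_type.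

Definition natural_act := rep (q := q) (r := r) monO lin_ext_linear (g := g).

Lemma natural_act_is_action : is_action natural_act.
Proof.
exact: (rep_action q_neq0 q2_neq1 r_gt1 qnum_r
  Omega_mon_out lin_ext_mon Omega_ext).
Qed.

Lemma natural_act_gen x v :
  natural_act (Ugen q r x) v = op q monO lin_ext_linear x v.
Proof.
exact: (rep_gen q_neq0 q2_neq1 r_gt1 qnum_r
  Omega_mon_out lin_ext_mon Omega_ext).
Qed.

Lemma natural_act_is_natural : is_natural natural_act.
Proof.
split=> [j v|j v|t v|v]; rewrite natural_act_gen.
- exact: (node_natural_E q_neq0 q2_neq1 Omega_mon_out lin_ext_mon Omega_ext).
- exact: (node_natural_F q_neq0 q2_neq1 Omega_mon_out lin_ext_mon Omega_ext).
- case: g t => t.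
    exact: (torus_eps q Omega_mon_out lin_ext_mon Omega_ext).
  exact: (torus_root q_neq0 Omega_mon_out lin_ext_mon Omega_ext).
by [].
Qed.

Lemma homog_is_submodule t : is_submodule natural_act (homog t).
Proof.
exact: (spanned_is_submodule q Omega_mon_out lin_ext_mon g
  (homog0 t) (@homogD t) (@homogZ t) (@homog_mon t) (@homog_dec t)).
Qed.

Hypothesis qnum_neq0 : forall (i : 'I_(m + n)) x,
  in_range r i x -> 0 < x -> qnum q x != 0.

Lemma homog_is_simple_hw t (a : wt) : extremal r a -> degree a = t%:Z ->
  is_simple_hw natural_act (homog t) a (mon a).
Proof.
exact: (simple_hw_extremal q_neq0 q2_neq1 r_gt1 qnum_r Omega_mon_out lin_ext_mon
  Omega_ext g (homog0 t) (@homogD t) (@homogZ t) (@homog_mon t) (@homog_dec t)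
  qnum_neq0 Omega_mon_neq0).
Qed.

End Omega.

(** * The highest weights *)

Section HighestWeights.
Variables m n : nat.
Local Notation wt := {ffun 'I_(m + n) -> int}.

(** Here [k] ranges over [nat], as in the sums that define the highest
weights. *)
Lemma eps_at k (x : 'I_(m + n)) : (eps k : wt) x = (x == k :> nat)%:R.
Proof. by rewrite ffunE; case: eqP. Qed.

Lemma omega_at k (x : 'I_(m + n)) : (omega k : wt) x = (x < k)%N%:R.
Proof.
elim: k => [|k IHk]; first by rewrite /omega big_geq // ffunE.
rewrite /omega big_nat_recr //= wtD -/(omega k) IHk eps_at.
by rewrite ltnS; case: ltngtP => _; rewrite ?addr0 ?add0r.
Qed.

(** The part of the highest weight in which the first [i - 1] entries of [I_1]
take their greatest value [c]. *)
Definition filled (c i : nat) : wt :=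
  \sum_(1 <= k < i) eps (m + k - 1)%N *+ c.

Lemma filledS c i : filled c i.+2 = filled c i.+1 + eps (m + i)%N *+ c.
Proof. by rewrite /filled big_nat_recr //= addnS subn1. Qed.

Lemma filled_at c i (x : 'I_(m + n)) :
  filled c i.+1 x = ((m <= x < m + i)%N * c)%N.
Proof.
elim: i => [|i IHi].
  by rewrite /filled big_geq // ffunE addn0 leqNgt andNb.
rewrite filledS wtD wtMn IHi eps_at addnS ltnS -mulrnA.
rewrite natz -PoszD; congr Posz; rewrite -mulnDl; congr (_ * _)%N.
by case: (ltngtP x (m + i)) => xi; case: (leqP m x) => mx //=; lia.
Qed.

Lemma degreeMn (a : wt) k : degree (a *+ k) = degree a *+ k.
Proof.
by rewrite /degree -sumrMnl; apply: eq_bigr => x _; rewrite wtMn.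
Qed.

Lemma degree_eps_nat k : (k < m + n)%N -> degree (eps k : wt) = 1.
Proof. by move=> kmn; apply: (degree_eps (Ordinal kmn)). Qed.

Lemma degree0 : degree (0 : wt) = 0.
Proof. by rewrite /degree big1 // => x _; rewrite ffunE. Qed.

Lemma degree_omega k : (k <= m + n)%N -> degree (omega k : wt) = k.
Proof.
elim: k => [|k IHk] kmn; first by rewrite /omega big_geq // degree0.
rewrite /omega big_nat_recr //= degreeD -/(omega k) IHk ?(ltnW kmn) //.
by rewrite degree_eps_nat // -addn1.
Qed.

Lemma degree_filled c i : (i <= n)%N -> degree (filled c i.+1) = (i * c)%N.
Proof.
elim: i => [|i IHi] il; first by rewrite /filled big_geq // degree0.
rewrite filledS degreeD degreeMn degree_eps_nat ?ltn_add2l //.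
by rewrite IHi ?(ltnW il) // natz -PoszD mulSn addnC.
Qed.

Lemma extremal_omega r t : (t <= m)%N ->
  (forall l, r = Some l -> (1 < l)%N) -> extremal r (omega t : wt).
Proof.
move=> tm r1; apply: (@extremal_shape m n r _ t).
- apply/admP => x; rewrite omega_at /in_range.
  case: (ltnP x m) => xm; first by case: (x < t)%N.
  have -> : (x < t)%N = false by rewrite ltnNge (leq_trans tm xm).
  by move: r1; case: r => [l /(_ l erefl)|] //=; lia.
- by move=> x xt; rewrite omega_at xt /in_range (leq_trans xt tm).
by move=> x tx; rewrite omega_at ltnNge (ltnW tx).
Qed.

Lemma extremal_omega_divided d :
  extremal None (omega m + eps m *+ d : wt).
Proof.
have at_ (x : 'I_(m + n)) : (omega m + eps m *+ d : wt) x =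
    ((x < m) + (x == m :> nat) * d)%N.
  by rewrite wtD wtMn omega_at eps_at -mulrnA !natz.
apply: (@extremal_shape m n None _ m).
- apply/admP => x; rewrite at_ /in_range; case: ltngtP; lia.
- by move=> x xm; rewrite at_ /in_range xm; lia.
by move=> x mx; rewrite at_; lia.
Qed.

Lemma extremal_omega_filled l i ti : (1 < l)%N -> (ti <= l - 1)%N ->
  extremal (Some l) (omega m + filled (l - 1) i.+1 + eps (m + i)%N *+ ti : wt).
Proof.
move=> l1 til.
have at_ (x : 'I_(m + n)) :
    (omega m + filled (l - 1) i.+1 + eps (m + i)%N *+ ti : wt) x =
    ((x < m) + (m <= x < m + i) * (l - 1) + (x == m + i :> nat) * ti)%N.
  by rewrite !wtD wtMn omega_at filled_at eps_at -mulrnA !natz.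
apply: (@extremal_shape m n (Some l) _ (m + i)).
- apply/admP => x; rewrite at_ /in_range; case: (ltnP x m) => xm /=.
    by have -> : (x == m + i :> nat) = false by lia.
  by case: (ltngtP x (m + i)) => xi /=; lia.
- move=> x xi; rewrite at_ /in_range xi; case: (ltnP x m) => xm /=.
    by have -> : (x == m + i :> nat) = false by lia.
  have -> : (x == m + i :> nat) = false by lia.
  by move: l1 => /=; clear; lia.
move=> x ix; rewrite at_.
have -> : (x < m)%N = false by lia.
have -> : (x < m + i)%N = false by lia.
have -> : (x == m + i :> nat) = false by lia.
by rewrite andbF.
Qed.
End HighestWeights.

(** In [I_0] the only positive entry is [1], so the condition on [q] only has to
be checked for the entries of [I_1]. *)
Lemma in_range_qnum (K : fieldType) (q : K) m n r (i : 'I_(m + n)) x :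
  q != 0 -> q ^+ 2 != 1 ->
  (forall s : nat, (0 < s)%N -> (forall l, r = Some l -> (s < l)%N) ->
     qnum q s != 0) ->
  in_range r i x -> 0 < x -> qnum q x != 0.
Proof.
move=> q0 q21 qs; case: x => // s /andP[_]; case: ifP => _ s1 s0.
  have -> : s = 1%N by move: s0 s1; lia.
  by rewrite qnum1 ?oner_neq0.
by apply: qs => // l rl; move: s1; rewrite rl; lia.
Qed.

Theorem theorem33 (K : closedFieldType) (charK : [pchar K] =i pred0)
    (q : K) (q_neq0 : q != 0) (q2_neq1 : q ^+ 2 != 1)
    (m n : nat) (n_ge1 : (1 <= n)%N) (g : lie_type) :
  (exists act : Uq q m n g None -> Omega K m n None -> Omega K m n None,
    [/\ is_action act, is_natural act,
        forall t : nat, is_submodule act (homog t)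
      & qchar q = 0%N ->
        (forall t : nat, (t <= m)%N ->
           is_V act (homog t) (omega t)
           /\ is_simple_hw act (homog t)
                (omega t) (mon (omega t)))
        /\
        (forall t : nat, (m < t)%N ->
           is_V act (homog t) (omega m + eps m *+ (t - m))
           /\ is_simple_hw act (homog t)
                (omega m + eps m *+ (t - m))
                (mon (omega m + eps m *+ (t - m))))])
  /\
  (forall l : nat, qchar q = l -> (2 < l)%N ->
   exists act : Uq q m n g (Some l) ->
                Omega K m n (Some l) -> Omega K m n (Some l),
    [/\ is_action act, is_natural act,
        forall t : nat, is_submodule act (homog t),
        forall t : nat, (t <= m)%N ->
          is_V act (homog t) (omega t)
      & forall t i ti : nat, (m < t)%N -> (t <= m + n * (l - 1))%N ->
          (1 <= i)%N -> (i <= n)%N -> (ti <= l - 1)%N ->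
          (t - m = (i - 1) * (l - 1) + ti)%N ->
          let lambda := omega m
            + (\sum_(1 <= k < i) eps (m + k - 1)%N *+ (l - 1))
            + eps (m + i - 1)%N *+ ti in
          is_V act (homog t) lambda
          /\ is_simple_hw act (homog t)
               lambda (mon lambda)]).
Proof.
have with_V r (act : Uq q m n g r -> Omega K m n r -> Omega K m n r) N a :
    is_simple_hw act N a (mon a) ->
    is_V act N a /\ is_simple_hw act N a (mon a).
  by move=> hw; split=> //; exists (mon a).
have deg_omega t : (t <= m)%N ->
    degree (omega t : {ffun 'I_(m + n) -> int}) = t.
  by move=> tm; rewrite degree_omega // (leq_trans tm) // leq_addr.
split.
  have r1 l : None = Some l -> (1 < l)%N by [].
  have r0 l : None = Some l -> qnum q l%:Z = 0 by [].
  exists (@natural_act K q m n None g); split.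
  - exact: natural_act_is_action.
  - exact: natural_act_is_natural.
  - by move=> t; apply: homog_is_submodule.
  move=> /qchar_eq0 qs.
  have qn (i : 'I_(m + n)) x : in_range None i x -> 0 < x -> qnum q x != 0.
    by apply: in_range_qnum => // s s0 _; apply: qs.
  split=> t tm; apply: with_V; apply: (homog_is_simple_hw _ _ _ _ _ qn) => //.
  - exact: extremal_omega.
  - exact: deg_omega.
  - exact: extremal_omega_divided.
  have m_lt : (m < m + n)%N by rewrite -[X in (X < _)%N]addn0 ltn_add2l.
  rewrite degreeD deg_omega // degreeMn degree_eps_nat //.
  by rewrite natz -PoszD subnKC // ltnW.
move=> l ql l2; have [] := qchar_gt0 ql (ltnW (ltnW l2)) => ql0 qs.
have r1 l' : Some l = Some l' -> (1 < l')%N by case=> <-; apply: ltnW.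
have r0 l' : Some l = Some l' -> qnum q l'%:Z = 0 by case=> <-.
have qn (i : 'I_(m + n)) x : in_range (Some l) i x -> 0 < x -> qnum q x != 0.
  by apply: in_range_qnum => // s s0 sl; apply: qs; rewrite s0 sl.
exists (@natural_act K q m n (Some l) g); split.
- exact: natural_act_is_action.
- exact: natural_act_is_natural.
- by move=> t; apply: homog_is_submodule.
- move=> t tm; apply: (with_V _ _ _ _ _).1.
  apply: (homog_is_simple_hw _ _ _ _ _ qn) => //; first exact: extremal_omega.
  exact: deg_omega.
(* From here on [i] is the number of full entries in [I_1]. *)
move=> t [//|i] ti mt _ _ iln til tE lambda; apply: with_V.
have -> : lambda = omega m + filled m n (l - 1) i.+1 + eps (m + i)%N *+ ti.
  by rewrite /lambda /filled addnS subSS subn0.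
apply: (homog_is_simple_hw _ _ _ _ _ qn) => //.
  by apply: extremal_omega_filled; rewrite // ltnW.
rewrite !degreeD deg_omega // degree_filled ?(ltnW iln) //.
rewrite degreeMn degree_eps_nat ?ltn_add2l // natz -!PoszD; congr Posz.
by move: tE; rewrite subn1 /=; lia.
Qed.
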